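(* Assume the Strong Exponential Time Hypothesis (SETH). Then for every function $f$ and every $\epsilon>0$, there is no algorithm that solves (IP) restricted to instances with non-negative constraint matrix in time $f(k)(d+1)^{(1-\epsilon)k}(mn)^{O(1)}$, where $A$ is the $m\times n$ constraint matrix, $d=\max\{b_1,\ldots,b_m\}$, and $k$ is the path-width of the column matroid of $A$.
   Context: (IP) is the decision problem: given an integer $m\times n$ matrix $A$ and an integer vector $b=(b_1,\dots,b_m)$, decide whether there exists $x\in\mathbb{Z}_{\ge0}^n$ with $Ax=b$. The column matroid $M(A)$ has the columns of $A$ as ground set $U$, with linearly independent sets of columns as independent sets; with rank function $r$, the connectivity function is $\lambda(X)=r(X)+r(U\setminus X)-r(U)+1$. A branch decomposition of $M(A)$ is a cubic tree $T$ with a map of $U$ onto/into the leaves of $T$; each edge $e$ induces a partition $(X_e,U\setminus X_e)$ by the two components of $T-e$, of width $\lambda(X_e)$, and the decomposition's width is the maximum edge width. The path-width of $M(A)$ is the minimum width of a branch decomposition whose tree is a cubic caterpillar (a tree obtained from a path by attaching leaves). For $q\ge3$, $\delta_q$ is the infimum of constants $c$ such that $q$-SAT with $n$ variables and $m$ clauses is solvable in time $2^{cn}m^{O(1)}$; SETH is the conjecture $\lim_{q\to\infty}\delta_q=1$. *)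

(* Defs.v *)
From mathcomp Require Import all_boot all_order all_algebra.
From mathcomp Require Import all_classical all_reals all_analysis.
Set Implicit Arguments.
Unset Strict Implicit.
Unset Printing Implicit Defensive.
Import Order.TTheory GRing.Theory Num.Theory numFieldNormedType.Exports.
Local Open Scope classical_set_scope.
Local Open Scope ring_scope.

(* Algorithms are programs of a word RAM with unit-cost instructions.  Programs
   are deterministic and structured.  The memory consists of arrays of integers:
   the name of an array is fixed in the program text (so a program only uses
   finitely many of them), the index of a cell is computed.  Scalar registers
   are the cells 0 of arrays.  Interleaving the arrays turns this into the RAM
   with a single memory at the price of a constant factor. *)

Definition state := nat -> int -> int.

Definition update (s : state) (a : nat) (k v : int) : state :=
  fun a' k' => if (a' == a) && (k' == k) then v else s a' k'.

Inductive binop := Add | Sub | Mul | Div | Mod | Eq | Lt.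

Inductive expr :=
| Const of int
| Read of nat & expr
| Op of binop & expr & expr.

Inductive cmd :=
| Skip
| Write of nat & expr & expr
| Seq of cmd & cmd
| If of expr & cmd & cmd
| While of expr & cmd.

Definition binop_sem (o : binop) (u v : int) : int :=
  match o with
  | Add => u + v
  | Sub => u - v
  | Mul => u * v
  | Div => (u %/ v)%Z
  | Mod => (u %% v)%Z
  | Eq => if u == v then 1 else 0
  | Lt => if u < v then 1 else 0
  end.

Definition word (W : nat) (v : int) : option int :=
  if (`|v| <= W)%N then Some v else None.

(* [W] bounds the absolute value of everything the processor handles: addresses,
   operands and results.  A computation exceeding [W] is stuck. *)
Fixpoint eval (W : nat) (s : state) (e : expr) : option int :=
  match e with
  | Const c => word W c
  | Read a i => if eval W s i is Some k then word W (s a k) else None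
  | Op o e1 e2 =>
      if eval W s e1 is Some u then
        if eval W s e2 is Some v then word W (binop_sem o u v) else None
      else None
  end.

Fixpoint ecost (e : expr) : nat :=
  match e with
  | Const _ => 1
  | Read _ i => (ecost i).+1
  | Op _ e1 e2 => (ecost e1 + ecost e2).+1
  end.

(* [exec W c s t s']: started in [s], the program [c] halts in [s'] after [t]
   steps, and all words are bounded by [W] along the way. *)
Inductive exec (W : nat) : cmd -> state -> nat -> state -> Prop :=
| ExecSkip s : exec W Skip s 1 s
| ExecWrite s a i e k v :
    eval W s i = Some k -> eval W s e = Some v ->
    exec W (Write a i e) s (ecost i + ecost e).+1 (update s a k v)
| ExecSeq c1 c2 s s1 s2 t1 t2 :
    exec W c1 s t1 s1 -> exec W c2 s1 t2 s2 ->
    exec W (Seq c1 c2) s (t1 + t2)%N s2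
| ExecIf e c1 c2 s s' v t :
    eval W s e = Some v -> exec W (if v != 0 then c1 else c2) s t s' ->
    exec W (If e c1 c2) s (ecost e + t).+1 s'
| ExecWhileStop e c s :
    eval W s e = Some 0 -> exec W (While e c) s (ecost e).+1 s
| ExecWhileStep e c s s1 s2 v t1 t2 :
    eval W s e = Some v -> v != 0 ->
    exec W c s t1 s1 -> exec W (While e c) s1 t2 s2 ->
    exec W (While e c) s (ecost e + t1 + t2).+1 s2.

(* The [a]-th sequence of an input fills the cells 0, 1, 2, ... of array [a];
   all other cells are 0. *)
Definition init (inp : seq (seq int)) : state :=
  fun a k => if k is Posz j then nth 0 (nth [::] inp a) j else 0.

Definition magnitude (inp : seq (seq int)) : nat :=
  (\sum_(l <- inp) \sum_(v <- l) `|v|.+1)%N.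

Record problem := Problem {
  instance : Type;
  legal : instance -> Prop;
  encode : instance -> seq (seq int);
  yes : instance -> Prop
}.

(* Some program decides every legal instance [x] in at most [T x] steps; the
   answer is in cell 0 of array 0.  The word length is O(log (N + T x)), where
   N is the magnitude of the input: this is the usual proviso under which
   arithmetic on words is charged unit cost. *)
Definition solvable_in_time (R : realType) (Q : problem)
    (T : instance Q -> R) : Prop :=
  exists (P : cmd) (K : nat), forall x : instance Q, legal x ->
    exists (W t : nat) (s : state),
      [/\ exec W P (init (encode x)) t s,
          t%:R <= T x,
          W%:R <= (2 + (magnitude (encode x))%:R + T x) ^+ K
        & s 0%N 0 != 0 <-> yes x].

(* [(true, v)] is the literal v, [(false, v)] its negation. *)
Record cnf := Cnf {
  nvars : nat;
  clauses : seq (seq (bool * 'I_nvars))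
}.

Definition satisfiable (F : cnf) : Prop :=
  exists a : 'I_(nvars F) -> bool,
    all (has (fun l => a l.2 == l.1)) (clauses F).

Definition is_qcnf (q : nat) (F : cnf) : Prop :=
  all (fun c => size c <= q)%N (clauses F).

(* DIMACS format: the literals of variable [i] are [i.+1] and [- i.+1], and
   every clause is terminated by 0. *)
Definition encode_literal (n : nat) (l : bool * 'I_n) : int :=
  if l.1 then (l.2.+1)%:Z else - (l.2.+1)%:Z.

Definition encode_cnf (F : cnf) : seq (seq int) :=
  [:: [:: (nvars F)%:Z; (size (clauses F))%:Z];
      flatten [seq rcons (map (@encode_literal _) c) 0 | c <- clauses F]].

Definition qSAT (q : nat) : problem :=
  Problem (is_qcnf q) encode_cnf satisfiable.

(* [m.+1] instead of [m] only matters for formulas without clauses, where a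
   power of [m] would be 0. *)
Definition qSAT_bound (R : realType) (c : R) (C : nat) (F : cnf) : R :=
  C%:R * 2 `^ (c * (nvars F)%:R) * ((size (clauses F)).+1%:R) ^+ C.

Definition delta (R : realType) (q : nat) : R :=
  inf [set c : R | exists C : nat,
         @solvable_in_time R (qSAT q) (qSAT_bound c C)].

Definition SETH (R : realType) : Prop :=
  delta R q @[q --> \oo] --> (1 : R).

(* The ground set consists of the column indices, so equal columns are distinct
   (parallel) elements. *)
Definition col_indep (m n : nat) (A : 'M[int]_(m, n)) (X : {set 'I_n}) : bool :=
  free [seq col j (map_mx intr A : 'M[rat]_(m, n)) | j <- enum X].

Definition col_rank (m n : nat) (A : 'M[int]_(m, n)) (X : {set 'I_n}) : nat :=
  \max_(Y : {set 'I_n} | (Y \subset X) && col_indep A Y) #|Y|.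

(* The truncated subtraction is exact, by subadditivity of the rank. *)
Definition connectivity (m n : nat) (A : 'M[int]_(m, n)) (X : {set 'I_n}) : nat :=
  (col_rank A X + col_rank A (~: X) - col_rank A [set: 'I_n]).+1.

Definition degree (V : finType) (e : rel V) (x : V) : nat := #|[set y | e x y]|.

Definition is_tree (V : finType) (e : rel V) : Prop :=
  [/\ symmetric e, irreflexive e, forall x y, connect e x y
    & forall c : seq V, ucycle e c -> (size c <= 2)%N].

Definition is_cubic (V : finType) (e : rel V) : Prop :=
  forall x, degree e x = 1%N \/ degree e x = 3%N.

Definition is_caterpillar (V : finType) (e : rel V) : Prop :=
  exists (x : V) (p : seq V),
    [/\ path e x p, uniq (x :: p)
      & forall y, y \notin x :: p ->
          degree e y = 1%N /\ exists2 z, z \in x :: p & e y z].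

(* Distinct elements label distinct leaves; leaves may be unlabelled. *)
Record branch_decomposition (U : finType) := BranchDecomposition {
  bd_vertex : finType;
  bd_edge : rel bd_vertex;
  bd_label : U -> bd_vertex;
  bd_tree : is_tree bd_edge;
  bd_cubic : is_cubic bd_edge;
  bd_label_inj : injective bd_label;
  bd_label_leaf : forall u, degree bd_edge (bd_label u) = 1%N
}.

Definition del_edge (V : finType) (e : rel V) (x y : V) : rel V :=
  [rel u v | [&& e u v, (u, v) != (x, y) & (u, v) != (y, x)]].

(* The elements displayed on the side of [x] when the edge [xy] is deleted. *)
Definition displayed (U : finType) (D : branch_decomposition U)
    (x y : bd_vertex D) : {set U} :=
  [set u | connect (del_edge (@bd_edge U D) x y) x (bd_label D u)].

Definition width (m n : nat) (A : 'M[int]_(m, n))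
    (D : branch_decomposition 'I_n) : nat :=
  \max_(p : bd_vertex D * bd_vertex D | bd_edge p.1 p.2)
    connectivity A (displayed p.1 p.2).

Definition nat_min (S : set nat) : nat :=
  xget 0%N [set k | S k /\ forall j, S j -> (k <= j)%N].

Definition pathwidth (m n : nat) (A : 'M[int]_(m, n)) : nat :=
  nat_min [set w | exists D : branch_decomposition 'I_n,
             is_caterpillar (@bd_edge _ D) /\ width A D = w].

Record ip := Ip {
  nrows : nat;
  ncols : nat;
  constraint : 'M[int]_(nrows, ncols);
  target : 'cV[int]_nrows
}.

Definition feasible (I : ip) : Prop :=
  exists x : 'cV[int]_(ncols I),
    (forall j, 0 <= x j 0) /\ constraint I *m x = target I.

(* Empty matrices are excluded: there [d] or a power of [m * n] degenerates. *)
Definition is_nonneg (I : ip) : Prop :=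
  [/\ (0 < nrows I)%N, (0 < ncols I)%N
    & forall i j, 0 <= constraint I i j].

Definition encode_ip (I : ip) : seq (seq int) :=
  [:: [:: (nrows I)%:Z; (ncols I)%:Z];
      [seq constraint I i j | i <- enum 'I_(nrows I), j <- enum 'I_(ncols I)];
      [seq target I i 0 | i <- enum 'I_(nrows I)]].

Definition IP_nonneg : problem := Problem is_nonneg encode_ip feasible.

(* The largest entry of the target vector, or 0 if all entries are negative, in
   which case the instance is trivially infeasible and the real power of [d + 1]
   would be meaningless. *)
Definition max_target (I : ip) : int :=
  \big[Order.max/0]_(i < nrows I) target I i 0.

Definition IP_bound (R : realType) (f : nat -> R) (eps : R) (C : nat) (I : ip) : R :=
  let k := pathwidth (constraint I) in
  let d := max_target I in
  f k * (d%:~R + 1) `^ ((1 - eps) * k%:R) * ((nrows I * ncols I)%:R) ^+ C.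

(* Main.v *)
Require Import Defs.
From mathcomp Require Import all_boot all_order all_algebra.
From mathcomp Require Import all_classical all_reals all_analysis.
From mathcomp Require Import zify ring lra.
Set Implicit Arguments.
Unset Strict Implicit.
Unset Printing Implicit Defensive.
Import Order.TTheory GRing.Theory Num.Theory.
Import fintype boot.finset Defs.
Local Open Scope ring_scope.

(* Reduction from q-SAT, executed by the RAM itself.  Cut the n variables into k
   blocks, k constant, and put D = 2 ^ (n / k + 1); an assignment to a block is a
   number below D.  Read the DIMACS text of the formula k times per symbol: step
   u = t k + i looks at the t-th symbol on behalf of block i and picks a pair
   (a, f), where a is the assignment to block i and the flag f claims that the
   symbol is a true literal of block i witnessing its clause.  Each pair is a
   column.  Rows with right-hand side 1 force every step to pick one pair; rows
   with right-hand side D - 1 and entries a, D - 1 - a force steps u and u + k to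
   agree on a; one row per clause asks for exactly one witness.  Listing the
   columns by step, a cut between two columns is crossed by at most k + 3 rows,
   so a caterpillar following this order has width at most k + 4, whereas
   (d + 1) ^ k is 2 ^ n up to a constant factor.  For k large in terms of eps and
   of the exponent of m n, an IP algorithm as excluded by the theorem would give
   delta_q <= 1 - min(eps, 1) / 2 for all q, contradicting SETH. *)

(** * Programs with bounded memory cells *)

(** The function f is arbitrary, not even monotone, so the path-width must stay bounded while n
    grows. This is why the number k of blocks is a constant and why f enters only through a finite
    sum of absolute values. The price is an instance of size about 2^(n/k), polynomially many times
    over in the number of clauses; it is affordable because it occurs only to the fixed power C. A
    cut has to remember one number below D per block. Tying step u to step u + k alone, and letting
    a step speak about a single block, keeps exactly these k numbers pending. With e = min(eps, 1),
    the excess 4 of the width and the power C are paid for by (1 - e)(k + 4) + C <= (1 - e/2) k,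
    which holds as soon as k e >= 2 (C + 4). A computation that exceeds its word bound is stuck, so
    running the reduction also requires a bound on every intermediate value. Such a bound follows
    from a bound on the memory cells and the syntactic cost of the expressions. *)

Lemma word_mono (W W' : nat) (u v : int) :
  (W <= W')%N -> word W u = Some v -> word W' u = Some v.
Proof.
rewrite /word => leW; case: ifP => // uW [<-].
by rewrite (leq_trans uW leW).
Qed.

Lemma eval_mono (W W' : nat) (s : state) (e : expr) (v : int) :
  (W <= W')%N -> eval W s e = Some v -> eval W' s e = Some v.
Proof.
move=> leW; elim: e v => [c|a i IHi|o e1 IH1 e2 IH2] v /=; first exact: word_mono.
  case E: (eval W s i) => [k|] //; rewrite (IHi _ E); exact: word_mono.
case E1: (eval W s e1) => [u|] //; case E2: (eval W s e2) => [u'|] //.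
by rewrite (IH1 _ E1) (IH2 _ E2); exact: word_mono.
Qed.

(** The set-up program and the program for (IP) come with separate word bounds; monotonicity lets
    both run under the sum of the two. *)
Lemma exec_mono (W W' : nat) (c : cmd) (s s' : state) (t : nat) :
  (W <= W')%N -> exec W c s t s' -> exec W' c s t s'.
Proof.
move=> leW; elim=> {c s s' t}.
- exact: ExecSkip.
- by move=> s a i e k v Hi He; apply: ExecWrite; apply: eval_mono leW _.
- by move=> c1 c2 s s1 s2 t1 t2 _ IH1 _ IH2; apply: ExecSeq IH1 IH2.
- by move=> e c1 c2 s s' v t He _; apply: ExecIf; apply: eval_mono leW He.
- by move=> e c s He; apply: ExecWhileStop; apply: eval_mono leW He.
- move=> e c s s1 s2 v t1 t2 He v0 _ IH1 _; apply: ExecWhileStep v0 IH1.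
  exact: eval_mono leW He.
Qed.

(** * Moving a program to other arrays *)

Fixpoint rename_expr (r : nat -> nat) (e : expr) : expr :=
  match e with
  | Const c => Const c
  | Read a i => Read (r a) (rename_expr r i)
  | Op o e1 e2 => Op o (rename_expr r e1) (rename_expr r e2)
  end.

Fixpoint rename (r : nat -> nat) (c : cmd) : cmd :=
  match c with
  | Skip => Skip
  | Write a i e => Write (r a) (rename_expr r i) (rename_expr r e)
  | Seq c1 c2 => Seq (rename r c1) (rename r c2)
  | If e c1 c2 => If (rename_expr r e) (rename r c1) (rename r c2)
  | While e c => While (rename_expr r e) (rename r c)
  end.

Lemma ecost_rename (r : nat -> nat) (e : expr) : ecost (rename_expr r e) = ecost e.
Proof. by elim: e => //= [a i ->|o e1 -> e2 ->]. Qed.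

Lemma eval_rename (r : nat -> nat) (W : nat) (s s' : state) (e : expr) :
  (forall a, s' (r a) = s a) -> eval W s' (rename_expr r e) = eval W s e.
Proof. by move=> ss'; elim: e => //= [a i ->|o e1 -> e2 ->]; rewrite ?ss'. Qed.

(** Agreement is required on the renamed arrays only, so scratch data left in other arrays cannot
    disturb the renamed program. *)
Lemma exec_rename (r : nat -> nat) (W : nat) (c : cmd) (s s1 : state) (t : nat) :
  injective r -> exec W c s t s1 ->
  forall s', (forall a, s' (r a) = s a) ->
  exists s1', exec W (rename r c) s' t s1' /\ forall a, s1' (r a) = s1 a.
Proof.
move=> r_inj; elim=> {c s s1 t}.
- by move=> s s' ss'; exists s'; split=> //; apply: ExecSkip.
- move=> s a i e k v Hi He s' ss'; exists (update s' (r a) k v); split.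
    rewrite /= -(ecost_rename r i) -(ecost_rename r e).
    by apply: ExecWrite; rewrite (eval_rename _ _ ss').
  move=> b; apply/funext => j.
  by rewrite /update (inj_eq r_inj) ss'.
- move=> c1 c2 s s1 s2 t1 t2 _ IH1 _ IH2 s' /IH1[s1' [H1 /IH2[s2' [H2 E2]]]].
  by exists s2'; split=> //; apply: ExecSeq H1 H2.
- move=> e c1 c2 s s1 v t He _ IH s' ss'; have [s1' [H1 E1]] := IH _ ss'.
  exists s1'; split=> //=; rewrite -(ecost_rename r e).
  apply: (@ExecIf _ _ _ _ _ _ v); first by rewrite (eval_rename _ _ ss').
  by move: H1; case: ifP.
- move=> e c s He s' ss'; exists s'; split=> //=; rewrite -(ecost_rename r e).
  by apply: ExecWhileStop; rewrite (eval_rename _ _ ss').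
- move=> e c s s1 s2 v t1 t2 He v0 _ IH1 _ IH2 s' ss'.
  have [s1' [H1 /IH2[s2' [H2 E2]]]] := IH1 _ ss'.
  exists s2'; split=> //=; rewrite -(ecost_rename r e).
  by apply: ExecWhileStep v0 H1 H2; rewrite (eval_rename _ _ ss').
Qed.

(** * Evaluation and loops over bounded cells *)

Fixpoint value (s : state) (e : expr) : int :=
  match e with
  | Const c => c
  | Read a i => s a (value s i)
  | Op o e1 e2 => binop_sem o (value s e1) (value s e2)
  end.

Fixpoint small_consts (B : nat) (e : expr) : bool :=
  match e with
  | Const c => (`|c| <= B)%N
  | Read _ i => small_consts B i
  | Op _ e1 e2 => small_consts B e1 && small_consts B e2
  end.

Definition bounded (B : nat) (s : state) : Prop := forall a k, (`|s a k| <= B)%N.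

(** A product dominates all seven operations, sums included, once both bounds are at least 2. Hence
    an expression of cost c over cells bounded by B has value at most B ^ c. *)
Lemma binop_sem_bound (o : binop) (u v : int) (x y : nat) :
  (1 < x)%N -> (1 < y)%N -> (`|u| <= x)%N -> (`|v| <= y)%N ->
  (`|binop_sem o u v| <= x * y)%N.
Proof.
move=> x1 y1 ux vy.
have addxy: (x + y <= x * y)%N by nia.
have one : (1 <= x * y)%N by nia.
case: o => /=.
- by lia.
- by lia.
- by rewrite abszM leq_mul.
- apply: (@leq_trans x); last by nia.
  apply: leq_trans ux; rewrite /divz.
  have sgv : (`|sgz v| <= 1)%N by rewrite /sgz; do 2?case: ifP.
  case: u => p; rewrite abszM; apply: leq_trans (leq_mul sgv (leqnn _)) _;
    rewrite mul1n.
  + exact: leq_div.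
  + by rewrite /= ltnS leq_div.
- have [->|v0] := eqVneq v 0; first by rewrite modz0; nia.
  have := modz_ge0 u v0; have := ltz_mod u v0; nia.
- by case: ifP.
- by case: ifP.
Qed.

Lemma value_bound (B : nat) (s : state) (e : expr) :
  (1 < B)%N -> bounded B s -> small_consts B e ->
  (`|value s e| <= B ^ ecost e)%N.
Proof.
move=> B1 sB; elim: e => [c|a i IH|o e1 IH1 e2 IH2] /=.
- by rewrite expn1.
- by move=> _; apply: leq_trans (sB _ _) _; rewrite expnS leq_pmulr // expn_gt0 ltnW.
- move=> /andP[/IH1 ? /IH2 ?].
  have cost_gt1 e : (1 < B ^ ecost e)%N.
    by rewrite -[1%N](exp1n (ecost e)) ltn_exp2r //; case: e.
  apply: (@leq_trans (B ^ ecost e1 * B ^ ecost e2)); first exact: binop_sem_bound.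
  by rewrite -expnD leq_exp2l.
Qed.

Lemma eval_value (B W : nat) (s : state) (e : expr) :
  (1 < B)%N -> bounded B s -> small_consts B e -> (B ^ ecost e <= W)%N ->
  eval W s e = Some (value s e).
Proof.
move=> B1 sB; elim: e => [c|a i IH|o e1 IH1 e2 IH2] /=.
- by rewrite /word expn1 => cB BW; rewrite (leq_trans cB BW).
- move=> iB BW; rewrite IH //; last first.
    by apply: leq_trans BW; rewrite leq_exp2l.
  rewrite /word (leq_trans (sB _ _)) //; apply: leq_trans BW.
  by rewrite expnS leq_pmulr // expn_gt0 ltnW.
- move=> /andP[e1B e2B] BW; rewrite IH1 //; last first.
    by apply: leq_trans BW; rewrite leq_exp2l // leqW // leq_addr.
  rewrite IH2 //; last first.
    by apply: leq_trans BW; rewrite leq_exp2l // leqW // leq_addl.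
  rewrite /word ifT //; apply: leq_trans BW.
  by have := @value_bound B s (Op o e1 e2) B1 sB; rewrite /= e1B e2B; apply.
Qed.

(** A total-correctness triple with a time bound. [B] bounds what is stored in cells, whereas [W]
    bounds intermediate values; [B] is reestablished at the end so that triples compose. *)
Definition reaches (W B : nat) (c : cmd) (s : state) (T : nat)
    (Q : state -> Prop) : Prop :=
  exists t s', [/\ exec W c s t s', (t <= T)%N, bounded B s' & Q s'].

Section Programs.
Variables (W B K : nat).
Hypotheses (B_gt1 : (1 < B)%N) (leBW : (B ^ K <= W)%N).

Definition fits (e : expr) := (ecost e <= K)%N && small_consts B e.

Lemma eval_fits (s : state) (e : expr) :
  bounded B s -> fits e -> eval W s e = Some (value s e).
Proof.
move=> sB /andP[eK eB]; apply: (@eval_value B) => //.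
by apply: leq_trans leBW; rewrite leq_exp2l.
Qed.

Lemma reaches_weaken (c : cmd) (s : state) (T T' : nat) (Q Q' : state -> Prop) :
  (T <= T')%N -> (forall s', bounded B s' -> Q s' -> Q' s') ->
  reaches W B c s T Q -> reaches W B c s T' Q'.
Proof.
move=> leT QQ' [t [s' [H tT s'B Qs']]]; exists t, s'; split=> //; last exact: QQ'.
exact: leq_trans leT.
Qed.

Lemma reaches_seq (c1 c2 : cmd) (s : state) (T1 T2 : nat) (Q1 Q : state -> Prop) :
  reaches W B c1 s T1 Q1 ->
  (forall s1, bounded B s1 -> Q1 s1 -> reaches W B c2 s1 T2 Q) ->
  reaches W B (Seq c1 c2) s (T1 + T2) Q.
Proof.
move=> [t1 [s1 [H1 leT1 s1B Q1s1]]] /(_ _ s1B Q1s1)[t2 [s2 [H2 leT2 s2B Qs2]]].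
exists (t1 + t2)%N, s2; split=> //; first exact: ExecSeq H1 H2.
exact: leq_add.
Qed.

Lemma reaches_write (a : nat) (i e : expr) (s : state) (Q : state -> Prop) :
  bounded B s -> fits i -> fits e -> (`|value s e| <= B)%N ->
  Q (update s a (value s i) (value s e)) ->
  reaches W B (Write a i e) s (ecost i + ecost e).+1 Q.
Proof.
move=> sB iK eK eB Qs.
exists (ecost i + ecost e).+1, (update s a (value s i) (value s e)); split=> //.
- by apply: ExecWrite; apply: eval_fits.
- by move=> b j; rewrite /update; case: ifP.
Qed.

Definition array (n : nat) (g : nat -> int) : int -> int :=
  fun k => if k is Posz j then if (j < n)%N then g j else 0 else 0.

Definition cell (v : int) : int -> int := array 1 (fun=> v).

(** Cell 0 of [p] is the loop counter and also the number of cells of [a] written so far. It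
    survives the loop, and later expressions read lengths from it. *)
Definition fill (a p : nat) (cond e : expr) : cmd :=
  While cond (Seq (Write a (Read p (Const 0)) e)
                  (Write p (Const 0) (Op Add (Read p (Const 0)) (Const 1)))).

Definition filled (s : state) (a p : nat) (g : nat -> int) (i : nat) (s' : state) :=
  [/\ s' a = array i g, s' p = cell i & forall b, b != a -> b != p -> s' b = s b].

Lemma filled_next (s s' : state) (a p : nat) (g : nat -> int) (i : nat) :
  a != p -> filled s a p g i s' ->
  filled s a p g i.+1 (update (update s' a i (g i)) p 0 i.+1).
Proof.
move=> ap [s'a s'p s'b]; split.
- apply/funext => -[j|j]; rewrite /update (negbTE ap) /= eqxx /= s'a /=.
    rewrite eqz_nat ltnS [in RHS]leq_eqVlt.
    by case: eqVneq => [->|].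
  by [].
- apply/funext => -[[|j]|j]; rewrite /update eqxx //= eq_sym (negbTE ap) /= s'p //.
- by move=> b ba bp; apply/funext => j; rewrite /update (negbTE ba) (negbTE bp) s'b.
Qed.

Lemma reaches_fill (a p n : nat) (cond e : expr) (s : state) (g : nat -> int) :
  a != p -> bounded B s -> fits cond -> fits e -> (4 <= K)%N ->
  s a = array 0 g -> s p = cell 0 -> (n <= B)%N ->
  (forall i, (i < n)%N -> (`|g i| <= B)%N) ->
  (forall i s', (i < n)%N -> filled s a p g i s' ->
     value s' cond != 0 /\ value s' e = g i) ->
  (forall s', filled s a p g n s' -> value s' cond = 0) ->
  reaches W B (fill a p cond e) s (n.+1 * (ecost cond + ecost e + 10))
    (filled s a p g n).
Proof.
move=> ap sB condK eK K4 sa sp nB gB step stop.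
(* One round costs the test, 1 for the loop, [ecost e + 3] for the first write and 6 for the
   increment of the counter. *)
pose tb := (ecost cond + ecost e + 10)%N.
have fits0 : fits (Const 0) by rewrite /fits /=; lia.
suff: forall d i s', (i + d)%N = n -> bounded B s' -> filled s a p g i s' ->
    reaches W B (fill a p cond e) s' (d.+1 * tb) (filled s a p g n).
  move=> H; apply: (H n 0%N) => //; split=> //.
elim=> [|d IH] i s' idn s'B fi.
  rewrite addn0 in idn; subst i.
  exists (ecost cond).+1, s'; split=> //; last by rewrite /tb; lia.
  by apply: ExecWhileStop; rewrite eval_fits // stop.
have ltin : (i < n)%N by lia.
have [c0 ei] := step _ _ ltin fi.
have [s'a s'p _] := fi.
have := @reaches_seq (Write a (Read p (Const 0)) e)
  (Write p (Const 0) (Op Add (Read p (Const 0)) (Const 1))) s' _ _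
  (fun s1 => s1 = update s' a i (g i)) (filled s a p g i.+1).
move=> /(_ (ecost e + 3)%N 6%N)[||].
- apply: (@reaches_weaken _ _ (ecost (Read p (Const 0)) + ecost e).+1 _
      (fun s1 => s1 = update s' a i (g i))) => //=; first by lia.
  apply: reaches_write => //; first by rewrite /fits /=; lia.
    by rewrite ei; exact: gB.
  by rewrite ei /= s'p.
- move=> s1 s1B ->{s1 s1B}.
  apply: (@reaches_weaken _ _ 6 _ (filled s a p g i.+1)) => //.
  have val : value (update s' a i (g i)) (Op Add (Read p (Const 0)) (Const 1)) = i.+1.
    by rewrite /= /update eq_sym (negbTE ap) /= s'p /=; lia.
  apply: reaches_write => //.
  + move=> b j; rewrite /update; case: ifP => // _; exact: gB.
  + by rewrite /fits /=; lia.
  + by rewrite val /=; lia.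
  + rewrite val; exact: filled_next.
move=> t1 [s1 [H1 t1b s1B f1]].
have [t2 [s2 [H2 t2b s2B f2]]] : reaches W B (fill a p cond e) s1 (d.+1 * tb) (filled s a p g n).
  by apply: (IH i.+1) => //; lia.
exists (ecost cond + t1 + t2).+1, s2; split=> //; last by rewrite mulSn /tb; lia.
by apply: ExecWhileStep c0 H1 H2; rewrite eval_fits.
Qed.

End Programs.

(** * Connectivity and caterpillars *)

Section ColumnSpace.
Variables (m n : nat) (A : 'M[int]_(m, n)).
Implicit Types X Y : {set 'I_n}.

Definition ratcol (j : 'I_n) : 'cV[rat]_m := col j (map_mx intr A).

Definition colspan X : {vspace 'cV[rat]_m} := span [seq ratcol j | j <- enum X].

Lemma colspanS X Y : X \subset Y -> (colspan X <= colspan Y)%VS.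
Proof.
move=> /subsetP XY; apply: sub_span => _ /mapP[j jX ->].
by apply: map_f; move: jX; rewrite !mem_enum => /XY.
Qed.

Lemma dim_colspan_indep X : col_indep A X -> \dim (colspan X) = #|X|.
Proof. by rewrite /col_indep /free => /eqP; rewrite size_map -cardE. Qed.

(** A maximal independent subset of [X] spans its columns, since a column outside the span could be
    added to it. Ranks become dimensions, for which the modular law is available. *)
Lemma col_rank_dim X : col_rank A X = \dim (colspan X).
Proof.
apply/eqP; rewrite eqn_leq; apply/andP; split.
  apply/bigmax_leqP => Y /andP[YX Yfree].
  by rewrite -dim_colspan_indep //; apply: dimvS; apply: colspanS.
pose P Y := (Y \subset X) && col_indep A Y.
have P0 : P set0 by rewrite /P sub0set /col_indep enum_set0 nil_free.
have [Y /maxsetP[PY maxY] _] := maxset_exists P0.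
have /andP[YX Yfree] := PY.
rewrite /col_rank; apply: leq_trans (@leq_bigmax_cond _ P (fun Z => #|Z|) _ PY).
rewrite -dim_colspan_indep //; apply: dimvS; apply/span_subvP => _ /mapP[j jX ->].
apply: contraT => jY.
have jNY : j \notin Y.
  by apply: contra jY => jY; apply: memv_span; apply: map_f; rewrite mem_enum.
have : P (j |: Y).
  rewrite /P subUset sub1set -mem_enum jX YX /= /col_indep.
  have /(perm_map ratcol)/perm_free-> : perm_eq (enum (j |: Y)) (j :: enum Y).
    apply: uniq_perm; rewrite /= ?enum_uniq ?mem_enum ?jNY // => i.
    by rewrite mem_enum in_cons mem_enum !inE.
  by rewrite /= free_cons jY.
by move/maxY => /(_ (subsetUr _ _)) YE; rewrite -YE setU11 in jNY.
Qed.

Lemma col_rankS X Y : X \subset Y -> (col_rank A X <= col_rank A Y)%N.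
Proof. by move=> XY; rewrite !col_rank_dim; apply/dimvS/colspanS. Qed.

Lemma col_rank_card X : (col_rank A X <= #|X|)%N.
Proof. by apply/bigmax_leqP => Y /andP[/subset_leq_card]. Qed.

Lemma connectivityC X : connectivity A (~: X) = connectivity A X.
Proof. by rewrite /connectivity setCK addnC. Qed.

Lemma connectivity1 (j : 'I_n) : (connectivity A [set j] <= 2)%N.
Proof.
have := col_rank_card [set j]; rewrite cards1 /connectivity.
by move=> r1; rewrite ltnS leq_subLR [(_ + 1)%N]addnC leq_add // col_rankS ?subsetT.
Qed.

Lemma colspan_zero_row X (v : 'cV[rat]_m) (i : 'I_m) :
  (forall j, j \in X -> A i j = 0) -> v \in colspan X -> v i 0 = 0.
Proof.
move=> A0; rewrite /colspan -[[seq _ | _ <- _]]/(tval (in_tuple _)).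
move/coord_span => ->; rewrite summxE big1 // => k _; rewrite mxE.
have /mapP[j] := mem_nth 0 (ltn_ord k); rewrite mem_enum => jX ->.
by rewrite !mxE A0 // mulr0.
Qed.

(* A vector in the intersection of both column spaces is supported on the rows
   that meet both sides. *)
Lemma connectivity_leq X (S : seq 'I_m) :
  (forall i j1 j2, j1 \in X -> j2 \notin X -> A i j1 != 0 -> A i j2 != 0 -> i \in S) ->
  (connectivity A X <= (size S).+1)%N.
Proof.
move=> shared.
have cap : (\dim (colspan X :&: colspan (~: X)) <= size S)%N.
  pose D := [seq delta_mx i 0 : 'cV[rat]_m | i <- S].
  rewrite -(size_map (fun i => delta_mx i 0 : 'cV[rat]_m) S).
  apply: leq_trans (dim_span D); apply: dimvS.
  apply/subvP => v; rewrite memv_cap => /andP[vX vX'].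
  rewrite [v]matrix_sum_delta; apply: memv_suml => i _; apply: memv_suml => k _.
  rewrite ord1; have [iS|iS] := boolP (i \in S).
    by apply: memvZ; apply: memv_span; apply: map_f.
  suff -> : v i 0 = 0 by rewrite scale0r mem0v.
  have [/existsP[j1 /andP[j1X Aj1]]|/existsPn H] :=
    boolP [exists j, (j \in X) && (A i j != 0)].
    apply: (colspan_zero_row _ vX') => j2; rewrite inE => j2X.
    by apply/eqP; apply: contraNT iS => Aj2; apply: (shared i j1 j2).
  apply: (colspan_zero_row _ vX) => j jX.
  by have := H j; rewrite jX /= negbK => /eqP.
have sum : (\dim (colspan X + colspan (~: X)) <= \dim (colspan [set: 'I_n]))%N.
  by apply: dimvS; rewrite subv_add !colspanS ?subsetT.
have := dimv_sum_cap (colspan X) (colspan (~: X)).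
rewrite /connectivity !col_rank_dim; lia.
Qed.

End ColumnSpace.

(** No component is computed: it suffices to exhibit a vertex set [Z] that only the edge xy leaves.
    Without this edge no path leaves or enters [Z], and by connectedness each vertex is still
    reachable from [x] or from [y]. *)
Lemma displayedE (U : finType) (D : branch_decomposition U) (x y : bd_vertex D)
    (Z : {pred bd_vertex D}) :
  bd_edge x y -> x \in Z -> y \notin Z ->
  (forall u v, bd_edge u v -> u \in Z -> v \notin Z -> u = x /\ v = y) ->
  displayed x y = [set u | bd_label D u \in Z].
Proof.
move=> exy xZ yZ cross; case: (bd_tree D) => sym _ conn _.
pose e' := del_edge (@bd_edge U D) x y.
have sym' : symmetric e'.
  move=> u v; rewrite /e' /del_edge /= sym; congr (_ && _).
  by rewrite !xpair_eqE andbC [(v == y) && _]andbC [(v == x) && _]andbC.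
have clZ u v : e' u v -> (u \in Z) = (v \in Z).
  move=> /and3P[euv n1 n2]; apply/idP/idP => h; apply: contraT => h'.
    by have [ux vy] := cross _ _ euv h h'; rewrite ux vy eqxx in n1.
  have [ux vy] := cross v u (etrans (sym _ _) euv) h h'.
  by rewrite ux vy eqxx in n2.
have connZ u v : connect e' u v -> (u \in Z) = (v \in Z).
  move=> /connectP[p]; elim: p u => [|w p IH] u /=; first by move=> _ ->.
  by move=> /andP[/clZ -> /IH H] /H.
have csym : connect_sym e' by apply: sym_connect_sym => u v; rewrite sym'.
have side v : connect e' x v || connect e' y v.
  have /connectP[p] := conn x v.
  elim/last_ind: p v => [|p w IH] v /=; first by move=> _ ->; rewrite connect0.
  rewrite rcons_path last_rcons => /andP[/IH/(_ erefl) H elw] ->.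
  have [/orP[/andP[/eqP xl /eqP yw]|/andP[/eqP yl /eqP xw]]|] :=
     boolP ((last x p == x) && (w == y) || (last x p == y) && (w == x)).
  - by rewrite yw connect0 orbT.
  - by rewrite xw connect0.
  rewrite negb_or => /andP[n1 n2].
  have /connect1 c1 : e' (last x p) w by rewrite /e' /del_edge /= !xpair_eqE n1 n2 elw.
  by case/orP: H => H; rewrite (connect_trans H c1) ?orbT.
apply/setP => u; rewrite !inE; apply/idP/idP => [/connZ <- //|uZ].
by case/orP: (side (bd_label D u)) => // /connZ; rewrite uZ (negbTE yZ).
Qed.

(** * Trees given by a parent function, and the comb *)

Lemma connect_to_root (n : nat) (e : rel 'I_n.+1) (par : nat -> nat) :
  (forall u v : 'I_n.+1, (0 < v)%N -> u = par v :> nat -> e v u) ->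
  (forall v, (0 < v)%N -> (par v < v)%N) ->
  forall v, connect e v ord0.
Proof.
move=> epar ltpar v; have [k] := ubnP (nat_of_ord v); elim: k v => // k IH v vk.
have [v0|v0] := posnP v; first by rewrite (_ : v = ord0) ?connect0 //; apply/val_inj.
have lt := ltpar _ v0.
have ltn : (par v < n.+1)%N by apply: ltn_trans lt (ltn_ord v).
apply: (@connect_trans _ _ (Ordinal ltn)); first by apply/connect1/epar.
by apply: IH => /=; lia.
Qed.

Definition parent_edge (par : nat -> nat) (n : nat) : rel 'I_n :=
  fun u v => (0 < v)%N && (u == par v :> nat) || (0 < u)%N && (v == par u :> nat).

(* On a cycle, both neighbours of the largest vertex would be its parent. *)
Lemma parent_edge_tree (par : nat -> nat) (n : nat) :
  (forall v, (0 < v)%N -> (par v < v)%N) -> is_tree (@parent_edge par n.+1).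
Proof.
move=> ltpar.
have sym : symmetric (@parent_edge par n.+1) by move=> u v; rewrite /parent_edge orbC.
split=> //.
- move=> u; rewrite /parent_edge orbb; apply/negP => /andP[/ltpar + /eqP].
  by move=> + uE; rewrite -uE ltnn.
- move=> x y; have root v : connect (@parent_edge par n.+1) v ord0.
    apply: (connect_to_root _ ltpar) => u {}v v0 uE.
    by rewrite /parent_edge v0 uE eqxx orbT.
  by apply: connect_trans (root x) _; rewrite sym_connect_sym.
- move=> c /andP[cyc unq]; rewrite leqNgt; apply/negP => c_gt2.
  have [x0 x0c] : exists x, x \in c.
    by case: c c_gt2 {cyc unq} => // x c _; exists x; rewrite mem_head.
  have [x xc xmax] : exists2 x, x \in c & forall y, y \in c -> (y <= x)%N.
    have [] := @arg_maxnP _ x0 (fun x => x \in c) (fun x : 'I_n.+1 => nat_of_ord x) x0c.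
    by move=> x xc xmax; exists x.
  have nb y : y \in c -> parent_edge par x y -> y = par x :> nat.
    move=> /xmax yx /orP[/andP[/ltpar h /eqP xE]|/andP[_ /eqP]//].
    by rewrite -xE ltnNge yx in h.
  have nextE := nb _ (etrans (mem_next c x) xc) (next_cycle cyc xc).
  have prevE : prev c x = par x :> nat.
    by apply: nb; rewrite ?mem_prev // sym; apply: prev_cycle.
  have pn : prev c x = next c x by apply/val_inj; rewrite /= nextE prevE.
  have : next c (next c x) = x by rewrite -[in LHS]pn next_prev.
  have [i c' rotE] := rot_to xc.
  rewrite -!(next_rot i unq) rotE.
  have : size (x :: c') = size c by rewrite -rotE size_rot.
  have : uniq (x :: c') by rewrite -rotE rot_uniq.
  case: c' {rotE} => [|y [|z c']] /=; try by move=> _ h; rewrite -h in c_gt2.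
  rewrite !inE !negb_or -!andbA => /and5P[xy xz _ yz _] _.
  by rewrite eqxx [y == x]eq_sym (negbTE xy) eqxx => zx; rewrite zx eqxx in xz.
Qed.

(** [degree] counts a classical set; this passes to finite sets, whose cardinals can be computed. *)
Lemma degree_card (V : finType) (e : rel V) (x : V) (S : {set V}) :
  (forall y, e x y = (y \in S)) -> degree e x = #|S|.
Proof.
move=> eS; apply: eq_card => y; rewrite -eS.
by apply/idP/idP; rewrite classical_sets.in_setE.
Qed.

(** The truncated difference sends 1 to 0, so the spine is 0, 1, 3, 5, ... and the tooth 2j + 2
    hangs on 2j + 1. *)
Definition comb_parent (v : nat) : nat := (if odd v then v - 2 else v - 1)%N.

Lemma comb_parent_lt (v : nat) : (0 < v)%N -> (comb_parent v < v)%N.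
Proof. by rewrite /comb_parent; case: ifP; lia. Qed.

(* The spine consists of 0 and the odd vertices, the teeth are the other even
   vertices. *)
Definition comb (n : nat) : rel 'I_(n.*2.+2) := parent_edge comb_parent (n:=n.*2.+2).

Section Comb.
Variable n : nat.
Implicit Types u v : 'I_(n.*2.+2).

Lemma combE u v : comb u v =
  ((0 < v)%N && (u == (if odd v then v - 2 else v - 1)%N :> nat)) ||
  ((0 < u)%N && (v == (if odd u then u - 2 else u - 1)%N :> nat)).
Proof. by []. Qed.

Lemma degree_comb_tooth u : (0 < u)%N -> ~~ odd u -> degree (@comb n) u = 1.
Proof.
move=> u0 uo; have lt : (u.-1 < n.*2.+2)%N by have := ltn_ord u; lia.
rewrite (@degree_card _ _ _ [set Ordinal lt]) ?cards1 // => v.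
rewrite !inE combE -val_eqE /= (negbTE uo) u0 /=; case: ifP; lia.
Qed.

(** The two ends of the spine, 0 and 2n + 1, are unlabelled leaves. They give every inner spine
    vertex two spine neighbours besides its tooth, hence degree 3. *)
Lemma comb_cubic : is_cubic (@comb n).
Proof.
move=> u; have [uo|uo] := boolP (odd u); last first.
  left; have [u0|u0] := posnP u; last exact: degree_comb_tooth.
  have lt : (1 < n.*2.+2)%N by [].
  rewrite (@degree_card _ _ _ [set Ordinal lt]) ?cards1 // => v.
  by rewrite !inE combE -val_eqE /= u0 /=; case: ifP; lia.
have u0 : (0 < u)%N by lia.
have lt0 : (u - 2 < n.*2.+2)%N by have := ltn_ord u; lia.
have [uN|uN] := eqVneq (u : nat) n.*2.+1.
  left; rewrite (@degree_card _ _ _ [set Ordinal lt0]) ?cards1 // => v.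
  have := ltn_ord v.
  by rewrite !inE combE -val_eqE /= uo u0 /=; case: ifP; lia.
right; have lt1 : (u + 1 < n.*2.+2)%N by have := ltn_ord u; lia.
have lt2 : (u + 2 < n.*2.+2)%N by have := ltn_ord u; lia.
rewrite (@degree_card _ _ _ [set Ordinal lt0; Ordinal lt1; Ordinal lt2]) => [|v].
  rewrite -setUA cardsU1 cards2 !inE -!val_eqE /=; lia.
rewrite !inE combE -!val_eqE /= uo u0 /=; case: ifP; lia.
Qed.

Lemma comb_caterpillar : is_caterpillar (@comb n).
Proof.
pose p : seq 'I_(n.*2.+2) := [seq inord i.*2.+1 | i <- iota 0 n.+1].
have pE i : (i <= n)%N -> (inord i.*2.+1 : 'I_(n.*2.+2)) = i.*2.+1 :> nat.
  by move=> ni; rewrite inordK //; lia.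
have memp v : odd v -> v \in p.
  move=> vo; apply/mapP; exists v./2; first by rewrite mem_iota; have := ltn_ord v; lia.
  by apply/val_inj; rewrite /= pE; have := ltn_ord v; lia.
exists ord0, p; split.
- rewrite /p -[iota 0 n.+1]/(0%N :: iota 1 n) /= combE /= pE //=.
  have H k i : (i + k <= n)%N -> path (@comb n) (inord i.*2.+1)
      [seq inord j.*2.+1 | j <- iota i.+1 k].
    elim: k i => //= k IH i ink.
    by rewrite IH ?andbT; last lia; rewrite combE !pE /=; do ?case: ifP; lia.
  exact: (H n 0%N).
- rewrite cons_uniq map_inj_in_uniq ?iota_uniq ?andbT; last first.
    move=> i j; rewrite !mem_iota => ? ? /(congr1 val) /=.
    by rewrite !pE; lia.
  by apply/negP => /mapP[i]; rewrite mem_iota => ? /(congr1 val) /=; rewrite pE; lia.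
- move=> v; rewrite in_cons negb_or => /andP[v0 vp].
  have vo : ~~ odd v by apply: contra vp; apply: memp.
  have v_gt0 : (0 < v)%N by rewrite lt0n.
  split; first exact: degree_comb_tooth.
  have lt : (v.-1 < n.*2.+2)%N by have := ltn_ord v; lia.
  exists (Ordinal lt); first by rewrite in_cons memp ?orbT //=; lia.
  by rewrite combE /= v_gt0 (negbTE vo); lia.
Qed.

Lemma tooth_subproof (j : 'I_n) : (j.*2.+2 < n.*2.+2)%N.
Proof. by have := ltn_ord j; lia. Qed.

Definition tooth (j : 'I_n) : 'I_(n.*2.+2) := Ordinal (tooth_subproof j).

Lemma tooth_inj : injective tooth.
Proof. by move=> i j /(congr1 val) /= ij; apply/val_inj => /=; lia. Qed.

Lemma degree_tooth (j : 'I_n) : degree (@comb n) (tooth j) = 1.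
Proof. by apply: degree_comb_tooth => //=; lia. Qed.

Definition comb_decomposition : branch_decomposition 'I_n :=
  BranchDecomposition (parent_edge_tree _ comb_parent_lt) comb_cubic tooth_inj
    degree_tooth.

Lemma displayed_comb_child (u v : bd_vertex comb_decomposition) :
  (0 < v)%N -> u = comb_parent v :> nat ->
  exists X : {set 'I_n}, [/\ displayed v u = X, displayed u v = ~: X
    & (exists j, X = [set j]) \/ exists p, X = ~: [set j : 'I_n | (j < p)%N]].
Proof.
move=> v0 uE.
have euv : comb u v by rewrite /comb /parent_edge v0 uE eqxx.
have evu : comb v u by rewrite /comb /parent_edge v0 uE eqxx orbT.
(* Below the edge lies a single tooth if [v] is even, and everything from [v] onwards if [v] is a
   spine vertex. *)
pose Z : {pred 'I_(n.*2.+2)} := [pred w : 'I__ | if odd v then (v <= w)%N else w == v].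
rewrite /comb_parent in uE.
have vZ : v \in Z by rewrite inE; case: ifP.
have uZ : u \notin Z by rewrite inE; case: ifP uE => ? ?; rewrite -?val_eqE /=; lia.
have cross w x : comb w x -> w \in Z -> x \notin Z -> w = v /\ x = u.
  rewrite combE !inE => wx wZ xZ; suff [wv xu] : w = v :> nat /\ x = u :> nat.
    by split; apply/val_inj.
  case: ifP wZ xZ uE => ?; rewrite -?val_eqE /=; move: wx; do 2!case: ifP; lia.
exists [set j | tooth j \in Z]; split.
- by apply: (@displayedE _ comb_decomposition).
- rewrite (@displayedE _ comb_decomposition u v [predC Z]) //.
  + by apply/setP => j; rewrite !inE.
  + by rewrite inE /= negbK.
  + move=> w x wx; rewrite !inE /= negbK => wZ xZ.
    by have [] := cross x w _ xZ wZ; first by rewrite /comb /parent_edge orbC.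
- have [vo|vo] := boolP (odd v).
    right; exists v./2; apply/setP => j; rewrite !inE vo /=; lia.
  left; have lt : (v./2.-1 < n)%N by have := ltn_ord v; lia.
  exists (Ordinal lt); apply/setP => j; rewrite !inE (negbTE vo) -!val_eqE /=; lia.
Qed.

Lemma displayed_comb (u v : bd_vertex comb_decomposition) :
  bd_edge u v -> exists X : {set 'I_n}, [/\ displayed u v = X \/ displayed u v = ~: X
    & (exists j, X = [set j]) \/ exists p, X = [set j : 'I_n | (j < p)%N]].
Proof.
have main (w x : bd_vertex comb_decomposition) : (0 < x)%N -> w = comb_parent x :> nat ->
    forall Y, Y = displayed w x \/ Y = displayed x w ->
    exists X : {set 'I_n}, [/\ Y = X \/ Y = ~: X
    & (exists j, X = [set j]) \/ exists p, X = [set j : 'I_n | (j < p)%N]].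
  move=> x0 wE Y; have [X [-> -> [jX|[p ->]]]] := displayed_comb_child x0 wE.
    by move=> YX; exists X; split; [tauto | left].
  exists [set j : 'I_n | (j < p)%N]; split; last by right; exists p.
  by move: H; rewrite setCK; tauto.
by case/orP => /andP[x0 /eqP wE]; apply: (main _ _ x0 wE); tauto.
Qed.
End Comb.

Lemma nat_min_le (S : set nat) (x : nat) : S x -> (nat_min S <= x)%N.
Proof.
by move=> Sx; rewrite /nat_min; case: xgetP => // y _ [_]; apply.
Qed.

(** Each edge of the comb splits off a single column or an initial segment of the columns. Single
    columns have connectivity at most 2, which is where [1 < w] enters. *)
Lemma pathwidth_leq (m n : nat) (A : 'M[int]_(m, n)) (w : nat) :
  (1 < w)%N ->
  (forall p, connectivity A [set j : 'I_n | (j < p)%N] <= w)%N ->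
  (pathwidth A <= w)%N.
Proof.
move=> w1 prefix.
apply: (@leq_trans (width A (comb_decomposition n))).
  by apply: nat_min_le; exists (comb_decomposition n); split=> //; apply: comb_caterpillar.
apply/bigmax_leqP => -[u v] /= /displayed_comb[X [XE XP]].
have -> : connectivity A (displayed u v) = connectivity A X.
  by case: XE => -> //; rewrite connectivityC.
by case: XP => [[j ->]|[p ->]] //; apply: leq_trans (connectivity1 _ _) _.
Qed.

(** * The integer program of a formula *)

Section FlatFormula.
Variable g : nat -> bool.

(** The number of the clause to which the symbol at position [t] belongs; a terminator belongs to
    the clause that it ends. *)
Definition zeros (w : seq int) (t : nat) : nat := count_mem 0 (take t w).

Definition literal_true (z : int) : bool :=
  (0 < `|z|)%N && (g `|z|.-1 == (0 < z)).

Definition dimacs (cs : seq (seq int)) : seq int := flatten [seq rcons c 0 | c <- cs].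

Definition all_witnessed (w : seq int) (m : nat) : Prop :=
  forall r, (r < m)%N ->
    exists t, [/\ (t < size w)%N, zeros w t = r & literal_true (nth 0 w t)].

Lemma zeros_dimacs_head (c : seq int) (cs : seq (seq int)) (t : nat) :
  0 \notin c -> (t <= size c)%N -> zeros (dimacs (c :: cs)) t = 0%N.
Proof.
move=> c0 tc; rewrite /zeros /dimacs /= cat_rcons takel_cat //.
by apply/count_memPn; apply: contra c0 => /mem_take.
Qed.

Lemma zeros_dimacs_tail (c : seq int) (cs : seq (seq int)) (t : nat) :
  0 \notin c -> zeros (dimacs (c :: cs)) ((size c).+1 + t) = (zeros (dimacs cs) t).+1.
Proof.
move=> c0; rewrite /zeros /dimacs /= take_cat size_rcons ltnNge leq_addr /= addKn.
by rewrite count_cat -cats1 count_cat /= (count_memPn c0).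
Qed.

Lemma nth_dimacs_tail (c : seq int) (cs : seq (seq int)) (t : nat) :
  nth 0 (dimacs (c :: cs)) ((size c).+1 + t) = nth 0 (dimacs cs) t.
Proof. by rewrite /dimacs /= nth_cat size_rcons ltnNge leq_addr /= addKn. Qed.

Lemma size_dimacs (c : seq int) (cs : seq (seq int)) :
  size (dimacs (c :: cs)) = ((size c).+1 + size (dimacs cs))%N.
Proof. by rewrite /dimacs /= size_cat size_rcons. Qed.

Lemma zeros_dimacs_lt (cs : seq (seq int)) (t : nat) :
  all (fun c => 0 \notin c) cs -> (t < size (dimacs cs))%N ->
  (zeros (dimacs cs) t < size cs)%N.
Proof.
elim: cs t => [|c cs IH] t //= /andP[c0 cs0].
rewrite size_dimacs; have [tc|tc] := leqP t (size c).
  by rewrite zeros_dimacs_head.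
by rewrite -(subnKC tc) ltn_add2l zeros_dimacs_tail // => /(IH _ cs0).
Qed.

Lemma zeros_dimacs_size (cs : seq (seq int)) :
  all (fun c => 0 \notin c) cs -> zeros (dimacs cs) (size (dimacs cs)) = size cs.
Proof.
elim: cs => //= c cs IH /andP[c0 cs0].
by rewrite size_dimacs zeros_dimacs_tail // IH.
Qed.

Lemma dimacs_witnessed (cs : seq (seq int)) :
  all (fun c => 0 \notin c) cs ->
  all (has literal_true) cs <-> all_witnessed (dimacs cs) (size cs).
Proof.
elim: cs => [|c cs IH] /= => [_|/andP[c0 cs0]]; first by split.
split=> [/andP[hc /(IH cs0) hcs] [_|r]|wit].
- exists (find literal_true c); rewrite size_dimacs.
  have lt : (find literal_true c < size c)%N by rewrite -has_find.
  rewrite zeros_dimacs_head ?(ltnW lt) //; split=> //; first by lia.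
  by rewrite /dimacs /= cat_rcons nth_cat lt nth_find.
- rewrite ltnS => /hcs[t [tL zt lt]]; exists ((size c).+1 + t)%N.
  by rewrite size_dimacs ltn_add2l zeros_dimacs_tail // zt nth_dimacs_tail.
- apply/andP; split.
    have [t [_ zt lt]] := wit 0%N isT.
    have tc : (t < size c)%N.
      rewrite ltnNge; apply/negP => ct.
      (* Position [size c] holds the terminator 0, which is never a true literal. *)
      have [tE|tc] := eqVneq t (size c).
        by move: lt; rewrite tE /dimacs /= cat_rcons nth_cat ltnn subnn.
      have {}tc : (size c < t)%N by lia.
      by rewrite -(subnKC tc) zeros_dimacs_tail in zt.
    apply/hasP; exists (nth 0 c t); first exact: mem_nth.
    by move: lt; rewrite /dimacs /= cat_rcons nth_cat tc.
  apply/(IH cs0) => r rm; have [t [tL zt lt]] := wit r.+1 rm.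
  have tc : (size c < t)%N.
    by rewrite ltnNge; apply/negP => tc; rewrite zeros_dimacs_head in zt.
  rewrite -(subnKC tc) in tL zt lt; exists (t - (size c).+1)%N.
  move: tL zt lt; rewrite size_dimacs ltn_add2l zeros_dimacs_tail // nth_dimacs_tail.
  by move=> tL [zt] lt.
Qed.

End FlatFormula.

Definition int_clauses (F : cnf) : seq (seq int) :=
  [seq map (@encode_literal _) c | c <- clauses F].

Lemma encode_cnfE (F : cnf) :
  encode_cnf F =
  [:: [:: (nvars F)%:Z; (size (clauses F))%:Z]; dimacs (int_clauses F)].
Proof. by rewrite /encode_cnf /dimacs -map_comp. Qed.

Lemma abs_encode_literal (n : nat) (l : bool * 'I_n) : `|encode_literal l|%N = l.2.+1.
Proof. by case: l => [[] i]; rewrite /encode_literal //= abszN. Qed.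

Lemma int_clauses_nonzero (F : cnf) : all (fun c => 0 \notin c) (int_clauses F).
Proof.
apply/allP => _ /mapP[c _ ->]; apply/mapP => -[l _ l0].
by have := abs_encode_literal l; rewrite -l0.
Qed.

Lemma literal_true_encode (n : nat) (g : nat -> bool) (l : bool * 'I_n) :
  literal_true g (encode_literal l) = (g l.2 == l.1).
Proof.
rewrite /literal_true abs_encode_literal /=; congr (_ == _).
by case: l => -[] i; rewrite /encode_literal /=; lia.
Qed.

Lemma satisfiable_witnessed (F : cnf) :
  satisfiable F <->
  exists g, all_witnessed g (dimacs (int_clauses F)) (size (clauses F)).
Proof.
have key g : all (has (fun l => g (nat_of_ord l.2) == l.1)) (clauses F) <->
    all_witnessed g (dimacs (int_clauses F)) (size (clauses F)).
  rewrite -(size_map (map (@encode_literal _)) (clauses F)).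
  rewrite -dimacs_witnessed ?int_clauses_nonzero // /int_clauses all_map.
  suff -> : all (has (fun l => g (nat_of_ord l.2) == l.1)) (clauses F) =
    all (preim (map (@encode_literal _)) (has (literal_true g))) (clauses F) by [].
  apply: eq_all => c /=; rewrite has_map; apply: eq_has => l /=.
  by rewrite literal_true_encode.
split=> [[a sat]|[g /key sat]]; last by exists (fun i => g i).
exists (fun i => if insub i is Some o then a o else false); apply/key.
move: sat; congr (is_true _); apply: eq_all => c /=; apply: eq_has => l /=.
by rewrite valK.
Qed.

Lemma mem_dimacs (F : cnf) (z : int) :
  z \in dimacs (int_clauses F) -> (`|z| <= nvars F)%N.
Proof.
move=> /flatten_mapP[_ /mapP[c _ ->]]; rewrite mem_rcons in_cons => /orP[/eqP->//|].
by move=> /mapP[l _ ->]; rewrite abs_encode_literal.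
Qed.

Lemma size_dimacs_qcnf (q : nat) (F : cnf) :
  is_qcnf q F -> (size (dimacs (int_clauses F)) <= size (clauses F) * q.+1)%N.
Proof.
rewrite /is_qcnf /int_clauses; elim: (clauses F) => //= c cs IH /andP[cq /IH le].
by rewrite size_dimacs size_map mulSn leq_add.
Qed.

(** * Binary digits and sums over blocks of columns *)

Lemma exists_bits (l : nat) (h : nat -> bool) :
  exists2 a, (a < 2 ^ l)%N & forall b, (b < l)%N -> odd (a %/ 2 ^ b) = h b.
Proof.
elim: l h => [|l IH] h; first by exists 0%N.
have [a al ab] := IH (fun b => h b.+1).
exists (h 0%N + a.*2)%N; first by rewrite expnS; case: (h 0%N); lia.
case=> [_|b]; first by rewrite expn0 divn1 oddD odd_double addbF oddb.
rewrite ltnS => /ab <-; rewrite expnS divnMA; congr (odd (_ %/ _)).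
by rewrite divn2; case: (h 0%N) => /=; rewrite ?add1n ?add0n ?uphalf_double ?doubleK.
Qed.

Lemma sum_blocks (N P : nat) (G : nat -> nat) :
  (\sum_(0 <= j < N * P) G j = \sum_(0 <= u < N) \sum_(0 <= c < P) G (u * P + c))%N.
Proof.
elim: N => [|N IH]; first by rewrite mul0n !big_nil.
rewrite big_nat_recr //= -IH mulSn addnC.
rewrite (@big_cat_nat _ _ _ (N * P)) ?leq_addr //=; congr (_ + _)%N.
by rewrite -{1}[(N * P)%N]add0n big_addn addKn; apply: eq_bigr => i _; rewrite addnC.
Qed.

Lemma sum_single (N v : nat) (G : nat -> nat) :
  (v < N)%N -> (forall u, (u < N)%N -> u != v -> G u = 0%N) ->
  (\sum_(0 <= u < N) G u = G v)%N.
Proof.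
move=> vN G0; rewrite big_mkord (bigD1 (Ordinal vN)) //= big1 ?addn0 // => u uv.
exact: G0.
Qed.

Lemma sum_eq1 (N : nat) (G : nat -> nat) :
  (\sum_(0 <= u < N) G u = 1)%N ->
  exists v, [/\ (v < N)%N, G v = 1%N & forall u, (u < N)%N -> u != v -> G u = 0%N].
Proof.
rewrite big_mkord => sum1.
have [v Gv] : exists v : 'I_N, (0 < G v)%N.
  apply/existsP; apply: contraT => /existsPn G0.
  by rewrite big1 // in sum1 => v _; apply/eqP; rewrite -leqn0 leqNgt.
move: sum1; rewrite (bigD1 v) //=; set S := (X in (_ + X)%N) => sum1.
have rest : S = 0%N by lia.
exists v; split=> [||u uN uv]; [exact: ltn_ord | lia |].
move/eqP: rest; rewrite sum_nat_eq0 => /forallP/(_ (Ordinal uN)).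
by rewrite -val_eqE /= uv => /eqP.
Qed.

(** * The matrix and the correctness of the reduction *)

Section Reduction.
Variables (k l m : nat) (w : seq int).

Let L := size w.
Let D := (2 ^ l)%N.

(** One round of k steps per symbol, and a further round past the end of the text. The [L * k] carry
    rows link consecutive rounds, and the extra round provides columns even for an empty text. *)
Definition steps := (L.+1 * k)%N.
Definition num_cols := (steps * (2 * D))%N.
Definition num_rows := (steps + L * k + m)%N.

(** The indicator that the symbol is a literal of block [u %% k] made true by the digits of [a]. Its
    form as a product of naturals is one that the RAM can evaluate. *)
Definition allowed (u a : nat) : nat :=
  let z := nth 0 w (u %/ k) in
  ((0 < `|z|) * ((`|z|.-1 %/ l == u %% k) * ((a %/ 2 ^ (`|z|.-1 %% l)) %% 2 == (0 < z)%R)))%N.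

(* Step [u] reads the literal [u %/ k] on behalf of the block [u %% k] of
   variables, [a] encodes the assignment to this block, and [f] claims that the
   literal is the witness of its clause. *)
Definition entry (i u a f : nat) : nat :=
  ((i == u) * (1 + f * (1 - allowed u a))
   + (u < L * k) * ((i == steps + u) * a)
   + (k <= u) * ((i + k == steps + u) * (D - 1 - a))
   + (i == steps + L * k + zeros w (u %/ k)) * f)%N.

Definition col_entry (i j : nat) : nat :=
  entry i (j %/ (2 * D)) (j %% (2 * D) %/ 2) (j %% (2 * D) %% 2).

Definition rhs (i : nat) : nat :=
  (1 + (steps <= i) * ((i < steps + L * k) * (D - 2)))%N.

Lemma col_entry_bound (i j : nat) : (col_entry i j <= 2 * D + 3)%N.
Proof.
rewrite /col_entry /entry -/D; set u := (j %/ _)%N.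
set c := (j %% _)%N; set q := allowed _ _.
have cD : (c %/ 2 < D)%N.
  by rewrite ltn_divLR // mulnC ltn_mod muln_gt0 expn_gt0.
have c2 : (c %% 2 < 2)%N by rewrite ltn_mod.
have le b x y : (x <= y)%N -> (nat_of_bool b * x <= y)%N.
  by case: b => xy; rewrite ?mul1n ?mul0n.
have f1 : (c %% 2 * (1 - q) <= 1)%N.
  by apply: (@leq_trans (1 * 1)) => //; apply: leq_mul => //; apply: leq_subr.
have h1 := le (i == u)%N _ _ (leq_add (leqnn 1) f1).
have h2 := le (u < size w * k)%N _ _ (le (i == steps + u)%N _ _ (ltnW cD)).
have h3 : (D - 1 - c %/ 2 <= D)%N by lia.
have {}h3 := le (k <= u)%N _ _ (le (i + k == steps + u)%N _ _ h3).
have c2' : (c %% 2 <= 1)%N by [].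
have h4 := le (i == steps + size w * k + zeros w (u %/ k))%N _ _ c2'.
apply: leq_trans (leq_add (leq_add (leq_add h1 h2) h3) h4) _; lia.
Qed.

Hypotheses (k_gt0 : (0 < k)%N) (l_gt0 : (0 < l)%N).

Lemma entry_select (i u a f : nat) : (i < steps)%N ->
  entry i u a f = ((i == u) * (1 + f * (1 - allowed u a)))%N.
Proof.
move=> iN; rewrite /entry.
have -> : (i == steps + u)%N = false by lia.
have -> : (i == steps + L * k + zeros w (u %/ k))%N = false by lia.
have [ku|ku] := leqP k u; last by rewrite !mul0n !muln0 !addn0.
have -> : (i + k == steps + u)%N = false by lia.
by rewrite !mul0n !muln0 !addn0.
Qed.

Lemma entry_carry (v u a f : nat) : (u < steps)%N -> (v < L * k)%N ->
  entry (steps + v) u a f = ((u == v) * a + (u == v + k) * (D - 1 - a))%N.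
Proof.
move=> uN vL; rewrite /entry.
have -> : (steps + v == u)%N = false by lia.
have -> : (steps + v == steps + L * k + zeros w (u %/ k))%N = false by lia.
rewrite mul0n add0n mul0n addn0 eqn_add2l -addnA eqn_add2l.
rewrite [v == u]eq_sym [(v + k)%N == u]eq_sym; congr (_ + _)%N.
  by case: eqVneq => [->|_]; rewrite ?vL ?mul1n // !mul0n muln0.
by case: eqVneq => [->|_]; rewrite ?leq_addl ?mul1n // !mul0n muln0.
Qed.

Lemma entry_clause (r u a f : nat) : (u < steps)%N ->
  entry (steps + L * k + r) u a f = ((zeros w (u %/ k) == r) * f)%N.
Proof.
move=> uN; rewrite /entry.
have -> : (steps + L * k + r == u)%N = false by lia.
have stepsE : steps = (k + L * k)%N by rewrite /steps mulSn.
have -> : (steps + L * k + r + k == steps + u)%N = false by lia.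
rewrite eqn_add2l [r == _]eq_sym !mul0n muln0 addn0 add0n.
have [uL|uL] := ltnP u (L * k); last by rewrite mul0n.
have -> : (steps + L * k + r == steps + u)%N = false by lia.
by rewrite mul0n muln0.
Qed.

Lemma allowed_true (g : nat -> bool) (u a : nat) :
  (forall b, (b < l)%N -> odd (a %/ 2 ^ b) = g (u %% k * l + b)%N) ->
  allowed u a = (literal_true g (nth 0 w (u %/ k)) &&
                 (`|nth 0%R w (u %/ k)|.-1 %/ l == u %% k)%N) :> nat.
Proof.
move=> ag; rewrite /allowed /literal_true; set z := nth 0 w _.
case: ltnP => //= z0; rewrite mul1n.
case: eqP => [blk|]; last by rewrite andbF mul0n.
rewrite andbT mul1n modn2 ag ?ltn_pmod // -blk -divn_eq.
by case: (g _); case: (0 < z).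
Qed.

Lemma col_entryE (i u b : nat) : (b < 2 * D)%N ->
  col_entry i (u * (2 * D) + b) = entry i u (b %/ 2) (b %% 2).
Proof.
move=> bD; have D0 : (0 < 2 * D)%N by apply: leq_ltn_trans bD.
by rewrite /col_entry divnMDl // modnMDl (modn_small bD) (divn_small bD) addn0.
Qed.

(** The left-hand side of row [i] when step [u] uses exactly its column [c u]; a pair (a, f) is
    numbered 2a + f. *)
Definition choice_row (c : nat -> nat) (i : nat) : nat :=
  (\sum_(0 <= u < steps) entry i u (c u %/ 2) (c u %% 2))%N.

Lemma sum_choice (c y : nat -> nat) (i : nat) :
  (forall u, (u < steps)%N -> (c u < 2 * D)%N) ->
  (forall u b, (u < steps)%N -> (b < 2 * D)%N ->
     y (u * (2 * D) + b)%N = (b == c u)) ->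
  (\sum_(0 <= j < num_cols) col_entry i j * y j = choice_row c i)%N.
Proof.
move=> cD yc; rewrite sum_blocks; apply: eq_big_nat => u /andP[_ uN].
rewrite (@sum_single _ (c u)) ?cD // => [|b bD bc].
  by rewrite yc ?cD // eqxx muln1 col_entryE ?cD.
by rewrite yc // (negbTE bc) muln0.
Qed.

Lemma choice_row_select (c : nat -> nat) (v : nat) : (v < steps)%N ->
  choice_row c v = (1 + (c v %% 2) * (1 - allowed v (c v %/ 2)))%N.
Proof.
move=> vN; rewrite /choice_row (@sum_single _ v) // => [|u uN uv];
  rewrite entry_select // ?eqxx ?mul1n //.
by rewrite eq_sym (negbTE uv).
Qed.

Lemma choice_row_carry (c : nat -> nat) (v : nat) : (v < L * k)%N ->
  choice_row c (steps + v) = (c v %/ 2 + (D - 1 - c (v + k) %/ 2))%N.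
Proof.
move=> vL; have stepsE : steps = (k + L * k)%N by rewrite /steps mulSn.
rewrite /choice_row (eq_big_nat _ _ (F2 := fun u =>
  ((u == v) * (c u %/ 2) + (u == v + k) * (D - 1 - c u %/ 2))%N)); last first.
  by move=> u /andP[_ uN]; rewrite entry_carry.
rewrite big_split /= (@sum_single _ v) ?(@sum_single _ (v + k)%N); lia.
Qed.

Lemma choice_row_clause (c : nat -> nat) (r : nat) :
  choice_row c (steps + L * k + r) =
  (\sum_(0 <= u < steps) (zeros w (u %/ k) == r) * (c u %% 2))%N.
Proof. by apply: eq_big_nat => u /andP[_ uN]; rewrite entry_clause. Qed.

Lemma rhs_cases (i : nat) : (i < num_rows)%N ->
  [\/ (i < steps)%N /\ rhs i = 1%N,
      exists2 v, (v < L * k)%N & i = (steps + v)%N /\ rhs i = (D - 1)%N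
    | exists2 r, (r < m)%N & i = (steps + L * k + r)%N /\ rhs i = 1%N].
Proof.
move=> iR; have D1 : (2 <= D)%N by rewrite /D -{1}(expn1 2) leq_exp2l.
rewrite /rhs; have [iN|Ni] := ltnP i steps; first by constructor 1.
have [iL|Li] := ltnP i (steps + L * k); [constructor 2|constructor 3].
  by exists (i - steps)%N; lia.
by rewrite /num_rows in iR; exists (i - (steps + L * k))%N; lia.
Qed.

Definition nat_feasible : Prop := exists y : nat -> nat, forall i, (i < num_rows)%N ->
  (\sum_(0 <= j < num_cols) col_entry i j * y j = rhs i)%N.

Definition choosable : Prop := exists2 c : nat -> nat,
  forall u, (u < steps)%N -> (c u < 2 * D)%N &
  forall i, (i < num_rows)%N -> choice_row c i = rhs i.

(* The selection row of a step forces exactly one of its columns to be used,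
   exactly once. *)
Lemma nat_feasible_choosable : nat_feasible <-> choosable.
Proof.
split=> [[y yE]|[c cD cE]]; last first.
  exists (fun j => j %% (2 * D) == c (j %/ (2 * D)))%N => i iR; rewrite -cE //.
  apply: sum_choice => // u b uN bD.
  have D0 : (0 < 2 * D)%N by apply: leq_ltn_trans bD.
  by rewrite divnMDl // modnMDl (modn_small bD) (divn_small bD) addn0.
have sel u : exists c, (u < steps)%N -> (c < 2 * D)%N /\
    forall b, (b < 2 * D)%N -> y (u * (2 * D) + b)%N = (b == c).
  have [uN|_] := ltnP u steps; last by exists 0%N.
  have uR : (u < num_rows)%N by rewrite /num_rows; lia.
  have := yE _ uR; rewrite sum_blocks (@sum_single _ u) // => [|u' u'N u'u]; last first.
    rewrite big_nat big1 // => b /andP[_ bD].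
    by rewrite col_entryE // entry_select // eq_sym (negbTE u'u).
  have -> : rhs u = 1%N by rewrite /rhs leqNgt uN.
  move=> /sum_eq1[c [cD c1 c0]]; exists c => _; split=> // b bD.
  have colE b' : (b' < 2 * D)%N -> (0 < col_entry u (u * (2 * D) + b'))%N.
    by move=> b'D; rewrite col_entryE // entry_select // eqxx mul1n.
  have [bc|bc] := eqVneq b c.
    by move/eqP: c1; rewrite bc muln_eq1 => /andP[_ /eqP].
  by have := c0 _ bD bc; have := colE _ bD; case: (col_entry _ _) => //= ? _; case: (y _).
have [c cP] := choice sel.
exists c => [u /cP[]//|i iR]; rewrite -yE //; apply/esym/sum_choice => [u /cP[]//|u b].
by move=> /cP[_]; apply.
Qed.

Hypothesis w_small : forall t, (`|nth 0%R w t| <= k * l)%N.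
Hypothesis zeros_size : zeros w L = m.

(** The carry rows make all rounds agree on the numbers of the blocks, and the digits of these
    numbers are the assignment. Conversely, an assignment together with one chosen true literal per
    clause determines all columns. *)
Lemma choosable_witnessed : choosable <-> exists g, all_witnessed g w m.
Proof.
have stepsE : steps = (k + L * k)%N by rewrite /steps mulSn.
have D0 : (0 < D)%N by rewrite /D expn_gt0.
have block_lt t : (0 < `|nth 0%R w t|)%N -> (`|nth 0%R w t|.-1 %/ l < k)%N.
  by have := w_small t; rewrite ltn_divLR //; lia.
split=> [[c cD cE]|[g wit]].
- have aD u : (u < steps)%N -> (c u %/ 2 < D)%N.
    by move=> /cD; rewrite ltn_divLR // mulnC.
  (* A false claim has entry 2 in the selection row and so overshoots its right-hand side 1. *)
  have sel u : (u < steps)%N -> ((c u %% 2) * (1 - allowed u (c u %/ 2)) = 0)%N.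
    move=> uN; have uR : (u < num_rows)%N by rewrite /num_rows; lia.
    have := cE _ uR; rewrite choice_row_select // /rhs leqNgt uN /=; lia.
  have carry v : (v < L * k)%N -> (c v %/ 2 = c (v + k) %/ 2)%N.
    move=> vL; have vR : (steps + v < num_rows)%N by rewrite /num_rows; lia.
    have := cE _ vR; rewrite choice_row_carry // /rhs leq_addr ltn_add2l vL !mul1n.
    have := aD v; have := aD (v + k)%N.
    have D1 : (2 <= D)%N by rewrite /D -{1}(expn1 2) leq_exp2l.
    lia.
  have blockE u : (u < steps)%N -> (c u %/ 2 = c (u %% k) %/ 2)%N.
    have [n] := ubnP u; elim: n u => // n IH u un uN.
    have [uk|ku] := ltnP u k; first by rewrite modn_small.
    rewrite -{1}(subnK ku) -carry; last by lia.
    by rewrite IH; [rewrite -{2}(subnK ku) modnDr | lia | lia].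
  (* The steps below [k] form the first round, so the choice at step i < k holds the number of block
     i. *)
  pose g (v : nat) := odd (c (v %/ l) %/ 2 %/ 2 ^ (v %% l))%N.
  exists g => r rm.
  have rR : (steps + L * k + r < num_rows)%N by rewrite /num_rows ltn_add2l.
  have := cE _ rR; rewrite choice_row_clause /rhs.
  have -> : (steps + L * k + r < steps + L * k)%N = false by lia.
  rewrite mul0n muln0 addn0 => /sum_eq1[u [uN /eqP]].
  rewrite muln_eq1 eqb1 => /andP[/eqP zr /eqP f1] _.
  have tL : (u %/ k <= L)%N by rewrite -ltnS ltn_divLR.
  (* The extra round past the end would witness clause number m, which has no row. *)
  have {}tL : (u %/ k < L)%N.
    rewrite ltn_neqAle tL andbT; apply/eqP => tE.
    by move: zr rm; rewrite tE zeros_size => ->; rewrite ltnn.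
  exists (u %/ k)%N; split=> //.
  have := sel u uN; rewrite f1 (@allowed_true g) => [|b bl].
    by case: (literal_true _ _).
  by rewrite /g divnMDl // (divn_small bl) addn0 modnMDl (modn_small bl) -blockE.
(* The clause rows demand exactly one witness, so one true literal per clause is singled out. *)
have [tau tauP] : exists tau : nat -> nat, forall r, (r < m)%N ->
    [/\ (tau r < L)%N, zeros w (tau r) = r & literal_true g (nth 0 w (tau r))].
  have H r : exists t, (r < m)%N -> [/\ (t < L)%N, zeros w t = r & literal_true g (nth 0 w t)].
    by have [/wit[t tP]|_] := ltnP r m; [exists t | exists 0%N].
  by have [tau tauP] := choice H; exists tau.
have bits i : exists a, (a < D)%N /\
    forall b, (b < l)%N -> odd (a %/ 2 ^ b) = g (i * l + b)%N.
  by have [a] := exists_bits l (fun b => g (i * l + b)%N); exists a.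
have [a aP] := choice bits.
(* The flag is raised in the round of the chosen literal only, and within that round only by the
   block that contains its variable. *)
pose f (u : nat) := [&& u %/ k == tau (zeros w (u %/ k)), (zeros w (u %/ k) < m)%N
               & `|nth 0%R w (u %/ k)|.-1 %/ l == u %% k]%N.
pose c (u : nat) := (a (u %% k) * 2 + f u)%N.
have c1 u : (c u %/ 2 = a (u %% k))%N by rewrite /c divnMDl // divn_small ?addn0 //; case: (f u).
have c2 u : (c u %% 2 = f u)%N by rewrite /c modnMDl modn_small //; case: (f u).
exists c => [u uN|i /rhs_cases[[iN ->]|[v vL [-> ->]]|[r rm [-> ->]]]].
- by have [+ _] := aP (u %% k)%N; rewrite /c; case: (f u); lia.
- rewrite choice_row_select // c1 c2 (@allowed_true g); last by have [_] := aP (i %% k)%N.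
  case fi : (f i) => //; move/and3P: fi => [/eqP tE zm ->].
  by have [_ _] := tauP _ zm; rewrite -tE => ->.
- rewrite choice_row_carry // !c1 modnDr.
  by have [+ _] := aP (v %% k)%N; lia.
- rewrite choice_row_clause; have [tL zt lt] := tauP _ rm.
  have z0 : (0 < `|nth 0%R w (tau r)|)%N by case/andP: lt.
  have bk := block_lt _ z0; set b := (_ %/ l)%N in bk.
  have div : ((tau r * k + b) %/ k = tau r)%N by rewrite divnMDl // divn_small ?addn0.
  have mod : ((tau r * k + b) %% k = b)%N by rewrite modnMDl modn_small.
  rewrite (@sum_single _ (tau r * k + b)%N).
  + by rewrite c2 /f div mod zt rm !eqxx.
  + by rewrite stepsE; nia.
  + move=> u uN uE; rewrite c2; apply/eqP; rewrite muln_eq0 !eqb0 -negb_and.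
    apply: contra uE => /andP[/eqP zr /and3P[/eqP tE _ /eqP bE]].
    by rewrite zr in tE; rewrite (divn_eq u k) -bE tE.
Qed.

End Reduction.

(** * The instance: encoding, right-hand side, path-width *)

Section Instance.
Variables (k l m : nat) (w : seq int).
Let L := size w.
Let D := (2 ^ l)%N.
Let N := steps k w.

Definition reduction : ip :=
  @Ip (num_rows k m w) (num_cols k l w)
    (\matrix_(i, j) (col_entry k l w i j)%:Z) (\col_i (rhs k l w i)%:Z).

Lemma feasible_reduction : feasible reduction <-> nat_feasible k l m w.
Proof.
have rowE (x : 'cV[int]_(num_cols k l w)) (y : nat -> nat) (i : 'I_(num_rows k m w)) :
    (forall j, x j 0 = (y j)%:Z) ->
    (constraint reduction *m x) i 0 =
    (\sum_(0 <= j < num_cols k l w) col_entry k l w i j * y j)%N%:Z.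
  move=> xy; rewrite big_mkord mxE (big_morph Posz PoszD (erefl _)).
  by apply: eq_bigr => j _; rewrite mxE xy PoszM.
split=> [[x [x0 xE]]|[y yE]].
  exists (fun j => if insub j is Some o then `|x o ord0|%N else 0%N) => i iR.
  have := congr1 (fun v : 'cV__ => v (Ordinal iR) 0) xE.
  rewrite (rowE _ (fun j => if insub j is Some o then `|x o ord0|%N else 0%N)).
    by rewrite mxE => -[].
  by move=> j; rewrite valK gez0_abs.
exists (\col_j (y j)%:Z); split; first by move=> j; rewrite mxE.
apply/colP => i; rewrite (rowE _ y); last by move=> j; rewrite mxE.
by rewrite yE // mxE.
Qed.

Hypotheses (k_gt0 : (0 < k)%N) (l_gt0 : (0 < l)%N).

Lemma nonneg_reduction : is_nonneg reduction.
Proof.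
split=> [||i j]; last by rewrite mxE.
  by rewrite /= /num_rows /steps; lia.
by rewrite /= /num_cols /steps !muln_gt0 expn_gt0 k_gt0.
Qed.

Lemma max_target_reduction : max_target reduction <= D.-1%:Z.
Proof.
have D1 : (2 <= D)%N by rewrite /D -{1}(expn1 2) leq_exp2l.
rewrite /max_target; elim/big_ind: _ => [//|x y xD yD|i _]; first by rewrite ge_max xD.
rewrite mxE lez_nat.
by case: (rhs_cases k_gt0 l_gt0 (ltn_ord i)) => [[_ ->]|[v _ [_ ->]]|[r _ [_ ->]]]; lia.
Qed.

(** In row-major order the entry at position p is in row p / M and column p mod M, so a single loop
    counter can produce the matrix. *)
Lemma encode_reduction :
  encode_ip reduction =
  [:: [:: (num_rows k m w)%:Z; (num_cols k l w)%:Z];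
      mkseq (fun p => (col_entry k l w (p %/ num_cols k l w) (p %% num_cols k l w))%:Z)
        (num_rows k m w * num_cols k l w);
      mkseq (fun i => (rhs k l w i)%:Z) (num_rows k m w)].
Proof.
have M0 : (0 < num_cols k l w)%N by have [] := nonneg_reduction.
rewrite /encode_ip /=; congr [:: _; _; _].
  set M := num_cols _ _ _ in M0 *; set R := num_rows _ _ _.
  pose h (i j : nat) := (col_entry k l w i j)%:Z.
  rewrite -[X in _ = X]/(mkseq (fun p => h (p %/ M)%N (p %% M)%N) (R * M)).
  transitivity [seq h i j | i <- iota 0 R, j <- iota 0 M].
    rewrite -!val_enum_ord allpairs_mapl allpairs_mapr; apply: eq_allpairs => i j.
    by rewrite mxE.
  elim: R => [//|R IH].
  rewrite -addn1 iotaD allpairs_cat IH /= cats0 /mkseq mulnDl mul1n iotaD map_cat.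
  congr (_ ++ _); rewrite !add0n -[in RHS](addn0 (R * M)%N) iotaDl -map_comp.
  apply/eq_in_map => j; rewrite mem_iota => /andP[_ jM] /=.
  by rewrite divnMDl // modnMDl divn_small ?modn_small // addn0.
rewrite /mkseq -val_enum_ord -map_comp; apply: eq_map => i.
by rewrite mxE.
Qed.

Lemma zeros_mono (t t' : nat) : (t <= t')%N -> (zeros w t <= zeros w t')%N.
Proof.
move=> tt'; rewrite /zeros -(take_takel w tt') -{2}(cat_take_drop t (take t' w)).
by rewrite count_cat leq_addr.
Qed.

(** A carry row meets two steps at distance k; only the interval between them is recorded, which is
    all that a cut detects. *)
Lemma entry_support (i u a f : nat) : (u < N)%N -> entry k l w i u a f != 0%N ->
  [\/ i = u,
      (N <= i < N + L * k)%N /\ (i <= N + u <= i + k)%N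
    | i = (N + L * k + zeros w (u %/ k))%N].
Proof.
have NE : N = (k + L * k)%N by rewrite /N /steps mulSn.
move=> uN; rewrite /entry -/N -/L -/D.
have [->|iu] := eqVneq i u; first by constructor 1.
have [->|iz] := eqVneq i (N + L * k + zeros w (u %/ k))%N; first by constructor 3.
rewrite !mul0n add0n addn0 addn_eq0 negb_and !muln_eq0 !eqb0 !negb_or !negbK => H.
constructor 2; case/orP: H => [/and3P[uL /eqP iE _]|/and3P[ku /eqP iE _]]; lia.
Qed.

Lemma pathwidth_reduction : (pathwidth (constraint reduction) <= k + 4)%N.
Proof.
have D0 : (0 < 2 * D)%N by rewrite muln_gt0 /= expn_gt0.
apply: pathwidth_leq => [|p]; first by lia.
pose u0 := (p %/ (2 * D))%N.
(* The rows that can meet both sides of a cut inside step [u0]: its selection row, k + 1 carry rows,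
   and the clause row of its symbol. *)
pose s := u0 :: rcons (iota (N + (u0 - k)) k.+1) (N + L * k + zeros w (u0 %/ k))%N.
pose S := [seq i <- enum 'I_(num_rows k m w) | nat_of_ord i \in s].
have sizeS : (size S <= k + 3)%N.
  have <- : size s = (k + 3)%N by rewrite /s /= size_rcons size_iota; lia.
  rewrite -(size_map (@nat_of_ord _)); apply: uniq_leq_size.
    by rewrite (map_inj_uniq (@ord_inj _)) filter_uniq ?enum_uniq.
  by move=> _ /mapP[i + ->]; rewrite mem_filter => /andP[].
apply: leq_trans (_ : (size S).+1 <= _)%N; last by lia.
apply: connectivity_leq => i j1 j2; rewrite !inE -leqNgt => j1p j2p.
rewrite !mxE => nz1 nz2; rewrite mem_filter mem_enum andbT.
have step_lt (j : 'I_(num_cols k l w)) : (j %/ (2 * D) < N)%N by rewrite ltn_divLR.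
have le1 : (j1 %/ (2 * D) <= u0)%N by rewrite leq_div2r // ltnW.
have le2 : (u0 <= j2 %/ (2 * D))%N by rewrite leq_div2r.
have := entry_support (step_lt j2) nz2; have := entry_support (step_lt j1) nz1.
have lt1 := step_lt j1; have lt2 := step_lt j2.
set u1 := (j1 %/ _)%N in le1 lt1 *; set u2 := (j2 %/ _)%N in le2 lt2 *.
rewrite in_cons mem_rcons in_cons mem_iota.
case=> [i1|[c1 d1]|i1]; case=> [i2|[c2 d2]|i2]; try lia.
(* Clause numbers increase along the text, so a clause met on both sides is the clause read at the
   cut. *)
have z1 : (zeros w (u1 %/ k) <= zeros w (u0 %/ k))%N by apply/zeros_mono/leq_div2r.
have z2 : (zeros w (u0 %/ k) <= zeros w (u2 %/ k))%N by apply/zeros_mono/leq_div2r.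
lia.
Qed.

End Instance.

(** * Computing the integer program *)

Section NatExpressions.
Variable s : state.
Implicit Types (e : expr) (x y : nat).

Definition Nat x := Const x%:Z.
Definition Scalar (a : nat) := Read a (Nat 0).
(** Machine subtraction is that of integers; multiplying by a comparison truncates it at 0. *)
Definition Monus e1 e2 := Op Mul (Op Lt e2 e1) (Op Sub e1 e2).
Definition Leq e1 e2 := Op Lt e1 (Op Add e2 (Nat 1)).
Definition Abs e := Op Mul e (Op Sub (Op Mul (Nat 2) (Op Lt (Nat 0) e)) (Nat 1)).

Lemma value_Nat x : value s (Nat x) = x.
Proof. by []. Qed.

Lemma value_Add e1 e2 x y :
  value s e1 = x -> value s e2 = y -> value s (Op Add e1 e2) = (x + y)%N.
Proof. by move=> /= -> ->. Qed.

Lemma value_Mul e1 e2 x y :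
  value s e1 = x -> value s e2 = y -> value s (Op Mul e1 e2) = (x * y)%N.
Proof. by move=> /= -> ->; rewrite PoszM. Qed.

Lemma value_Div e1 e2 x y :
  value s e1 = x -> value s e2 = y -> value s (Op Div e1 e2) = (x %/ y)%N.
Proof. by move=> /= -> ->; rewrite divz_nat. Qed.

Lemma value_Mod e1 e2 x y :
  value s e1 = x -> value s e2 = y -> value s (Op Mod e1 e2) = (x %% y)%N.
Proof. by move=> /= -> ->; rewrite modz_nat. Qed.

Lemma value_Eq e1 e2 x y :
  value s e1 = x -> value s e2 = y -> value s (Op Eq e1 e2) = (x == y)%N.
Proof. by move=> /= -> ->; rewrite eqz_nat; case: ifP. Qed.

Lemma value_Lt e1 e2 x y :
  value s e1 = x -> value s e2 = y -> value s (Op Lt e1 e2) = (x < y)%N.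
Proof. by move=> /= -> ->; rewrite ltz_nat; case: ifP. Qed.

Lemma value_Leq e1 e2 x y :
  value s e1 = x -> value s e2 = y -> value s (Leq e1 e2) = (x <= y)%N.
Proof.
move=> vx vy; have -> : (x <= y)%N = (x < y + 1)%N by rewrite addn1 ltnS.
by apply: value_Lt => //; apply: value_Add.
Qed.

Lemma value_Monus e1 e2 x y :
  value s e1 = x -> value s e2 = y -> value s (Monus e1 e2) = (x - y)%N.
Proof. by move=> /= -> ->; case: ifP; lia. Qed.

Lemma value_Abs e : value s (Abs e) = `|value s e|%N.
Proof. by rewrite /=; case: ifP; lia. Qed.

Lemma value_pos e (z : int) :
  value s e = z -> value s (Op Lt (Nat 0) e) = (0 < z).
Proof. by move=> /= ->; case: ifP. Qed.

Lemma value_Read a e x : value s e = x -> value s (Read a e) = s a x.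
Proof. by move=> /= ->. Qed.

Lemma value_Scalar a x : s a = cell x -> value s (Scalar a) = x.
Proof. by move=> /= ->. Qed.

Lemma value_Read_array a e (n x : nat) (g : nat -> int) :
  s a = array n g -> value s e = x -> (x < n)%N -> value s (Read a e) = g x.
Proof. by move=> /= -> -> /= ->. Qed.

Lemma value_Read_nat a e (n x : nat) (g : nat -> nat) :
  s a = array n (fun j => g j) -> value s e = x -> (x < n)%N ->
  value s (Read a e) = g x.
Proof. exact: value_Read_array. Qed.

Lemma value_Read_array_default a e (n x : nat) (g : nat -> nat) :
  s a = array n (fun j => g j) -> value s e = x ->
  value s (Read a e) = (if x < n then g x else 0)%N.
Proof. by move=> /= -> -> /=; case: ifP. Qed.

Lemma value_eq0 e (z : int) :
  value s e = z -> value s (Op Eq e (Nat 0)) = (z == 0).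
Proof. by move=> /= ->; case: ifP. Qed.

Lemma value_eqN e x y : value s e = x -> x = y -> value s e = y.
Proof. by move=> -> ->. Qed.

End NatExpressions.

(* Array 0 holds the two dimensions and array 1 the input formula.  The powers of
   2 go to array 2, the clause numbers to array 4, the constraint matrix to array
   8 and the right-hand side to array 9; 3, 5, 6 and 7 are the loop counters. *)
Section SetupProgram.
Variable k : nat.

Definition pow_cond :=
  Op Lt (Scalar 3) (Op Add (Op Div (Read 0 (Nat 0)) (Nat k)) (Nat 2)).
(** In round 0 the truncated index is 0 and that cell still holds 0, so only the first summand
    counts and gives 2 ^ 0. *)
Definition pow_expr :=
  Op Add (Op Eq (Scalar 3) (Nat 0)) (Op Mul (Nat 2) (Read 2 (Monus (Scalar 3) (Nat 1)))).

Definition clause_count := Read 0 (Nat 1).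
(** The input does not state the length of the text. The loop runs until m terminators have been
    counted, and its counter then stands at L + 1, the number of rounds. *)
Definition zeros_cond :=
  Op Add (Op Eq (Scalar 5) (Nat 0))
    (Op Lt (Read 4 (Monus (Scalar 5) (Nat 1))) clause_count).
Definition zeros_expr :=
  Op Mul (Op Lt (Nat 0) (Scalar 5))
    (Op Add (Read 4 (Monus (Scalar 5) (Nat 1)))
            (Op Eq (Read 1 (Monus (Scalar 5) (Nat 1))) (Nat 0))).

Definition len_expr := Monus (Scalar 3) (Nat 1).
Definition dim_expr := Read 2 len_expr.
Definition width_expr := Op Mul (Nat 2) dim_expr.
Definition steps_expr := Op Mul (Scalar 5) (Nat k).
Definition carries_expr := Monus steps_expr (Nat k).
Definition cols_expr := Op Mul steps_expr width_expr.
Definition rows_expr := Op Add (Op Add steps_expr carries_expr) clause_count.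

Definition row_expr := Op Div (Scalar 6) cols_expr.
Definition col_expr := Op Mod (Scalar 6) cols_expr.
Definition step_expr := Op Div col_expr width_expr.
Definition assign_expr := Op Div (Op Mod col_expr width_expr) (Nat 2).
Definition flag_expr := Op Mod (Op Mod col_expr width_expr) (Nat 2).
Definition literal_expr := Read 1 (Op Div step_expr (Nat k)).
Definition var_expr := Monus (Abs literal_expr) (Nat 1).

Definition allowed_expr :=
  Op Mul (Op Lt (Nat 0) (Abs literal_expr))
    (Op Mul (Op Eq (Op Div var_expr len_expr) (Op Mod step_expr (Nat k)))
       (Op Eq (Op Mod (Op Div assign_expr (Read 2 (Op Mod var_expr len_expr))) (Nat 2))
              (Op Lt (Nat 0) literal_expr))).

Definition entry_expr :=
  Op Add (Op Add (Op Add
    (Op Mul (Op Eq row_expr step_expr)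
       (Op Add (Nat 1) (Op Mul flag_expr (Monus (Nat 1) allowed_expr))))
    (Op Mul (Op Lt step_expr carries_expr)
       (Op Mul (Op Eq row_expr (Op Add steps_expr step_expr)) assign_expr)))
    (Op Mul (Leq (Nat k) step_expr)
       (Op Mul (Op Eq (Op Add row_expr (Nat k)) (Op Add steps_expr step_expr))
          (Monus (Monus dim_expr (Nat 1)) assign_expr))))
    (Op Mul (Op Eq row_expr (Op Add (Op Add steps_expr carries_expr)
                                (Read 4 (Op Div step_expr (Nat k)))))
       flag_expr).
Definition entry_cond := Op Lt (Scalar 6) (Op Mul rows_expr cols_expr).

Definition rhs_expr :=
  Op Add (Nat 1) (Op Mul (Leq steps_expr (Scalar 7))
    (Op Mul (Op Lt (Scalar 7) (Op Add steps_expr carries_expr)) (Monus dim_expr (Nat 2)))).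
Definition rhs_cond := Op Lt (Scalar 7) rows_expr.

Definition setup :=
  Seq (fill 2 3 pow_cond pow_expr)
  (Seq (fill 4 5 zeros_cond zeros_expr)
  (Seq (fill 8 6 entry_cond entry_expr)
  (Seq (fill 9 7 rhs_cond rhs_expr)
  (Seq (Write 0 (Nat 0) rows_expr) (Write 0 (Nat 1) cols_expr))))).

(** The sum bounds the cost of each expression crudely; the summand 4 pays for the increment of a
    loop counter. *)
Definition setup_cost : nat :=
  ecost pow_cond + ecost pow_expr + ecost zeros_cond + ecost zeros_expr +
  ecost entry_cond + ecost entry_expr + ecost rhs_cond + ecost rhs_expr +
  ecost rows_expr + ecost cols_expr + 4.

Definition setup_exprs := [:: pow_cond; pow_expr; zeros_cond; zeros_expr;
  entry_cond; entry_expr; rhs_cond; rhs_expr; rows_expr; cols_expr].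

Lemma setup_fits (B i : nat) : (k + 2 <= B)%N ->
  fits B setup_cost (nth (Nat 0) setup_exprs i).
Proof.
move=> kB; have all_fit : all (fits B setup_cost) setup_exprs; last first.
  have := all_nthP (Nat 0) all_fit i; case: ltnP => [_ /(_ isT)//|ge _].
  by rewrite nth_default // /fits /= (leq_trans _ (leq_addl _ 4)).
have B2 : (2 <= B)%N by lia.
have B1 : (1 <= B)%N by lia.
have {}kB : (k <= B)%N by lia.
rewrite /setup_exprs /= /fits /setup_cost.
do ![apply/andP; split=> //]; try lia; by rewrite /= ?kB ?B1 ?B2.
Qed.

End SetupProgram.

(** Arrays 1 and 2 of the (IP) program become 8 and 9, where the set-up leaves matrix and right-hand
    side; its further arrays become 10, 11, ..., which are still 0. Array 0 stays in place, since it
    carries the dimensions and the answer. *)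
Definition ip_array (a : nat) : nat := if a == 0%N then 0%N else (a + 7)%N.

Lemma ip_array_inj : injective ip_array.
Proof. by move=> a b; rewrite /ip_array; do 2!case: eqP; lia. Qed.

Lemma init_mkseq (h : nat -> int) (n : nat) :
  (fun k : int => if k is Posz j then nth 0 (mkseq h n) j else 0) = array n h.
Proof.
apply/funext => -[j|j] //=; case: ltnP => jn; first by rewrite nth_mkseq.
by rewrite nth_default ?size_mkseq.
Qed.

(** * Correctness and cost of the set-up program *)

Section SetupCorrect.
Variables (k n m l : nat) (w : seq int) (B W : nat).
Hypotheses (k_gt0 : (0 < k)%N) (lE : l = (n %/ k).+1).
Hypothesis zeros_lt : forall t, (t < size w)%N -> (zeros w t < m)%N.
Hypothesis zeros_size : zeros w (size w) = m.

Let s0 := init [:: [:: n%:Z; m%:Z]; w].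
Let L := size w.
Let D := (2 ^ l)%N.
Let N := steps k w.
Let M := num_cols k l w.
Let R := num_rows k m w.

Let l_gt0 : (0 < l)%N. Proof. by rewrite lE. Qed.

Section AfterZeros.
Variable s : state.
Hypotheses (s2 : s 2 = array l.+1 (fun j => (2 ^ j)%N)) (s3 : s 3 = cell l.+1).
Hypotheses (s4 : s 4 = array L.+1 (fun t => zeros w t)) (s5 : s 5 = cell L.+1).
Hypotheses (s0E : s 0 = s0 0) (s1E : s 1 = s0 1).

Lemma value_clause_count : value s clause_count = m.
Proof. by rewrite /= s0E. Qed.

Lemma value_len : value s len_expr = l.
Proof.
apply: value_eqN (subn1 l.+1); apply: value_Monus => //; exact: value_Scalar.
Qed.

Lemma value_dim : value s dim_expr = D.
Proof. by apply: (value_Read_nat s2 value_len). Qed.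

Lemma value_width : value s width_expr = (2 * D)%N.
Proof. by apply: value_Mul value_dim. Qed.

Lemma value_steps : value s (steps_expr k) = N.
Proof. by apply: value_Mul => //; apply: value_Scalar. Qed.

Lemma value_carries : value s (carries_expr k) = (L * k)%N.
Proof.
apply: (value_eqN (value_Monus value_steps (value_Nat _ _))).
by rewrite /N /steps mulSn addKn.
Qed.

Lemma value_cols : value s (cols_expr k) = M.
Proof. exact: value_Mul value_steps value_width. Qed.

Lemma value_rows : value s (rows_expr k) = R.
Proof. exact: value_Add (value_Add value_steps value_carries) value_clause_count. Qed.

Lemma value_rhs (i : nat) : s 7 = cell i -> value s (rhs_expr k) = rhs k l w i.
Proof.
move=> s7; have vi := value_Scalar s7.
apply: value_Add => //; apply: value_Mul; first exact: value_Leq value_steps vi.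
apply: value_Mul; first exact: value_Lt vi (value_Add value_steps value_carries).
exact: value_Monus value_dim (value_Nat _ _).
Qed.

Lemma value_entry (p : nat) : (0 < M)%N -> s 6 = cell p ->
  value s (entry_expr k) = col_entry k l w (p %/ M) (p %% M).
Proof.
move=> M0 s6; have vp := value_Scalar s6.
have vi : value s (row_expr k) = (p %/ M)%N := value_Div vp value_cols.
have vj : value s (col_expr k) = (p %% M)%N := value_Mod vp value_cols.
set i := (p %/ M)%N in vi *; set j := (p %% M)%N in vj *.
have jM : (j < M)%N by rewrite ltn_mod.
rewrite /col_entry -/D; set u := (j %/ (2 * D))%N; set a := (j %% (2 * D) %/ 2)%N.
set f := (j %% (2 * D) %% 2)%N.
have vu : value s (step_expr k) = u := value_Div vj value_width.
have va : value s (assign_expr k) = a.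
  exact: value_Div (value_Mod vj value_width) (value_Nat _ _).
have vf : value s (flag_expr k) = f.
  exact: value_Mod (value_Mod vj value_width) (value_Nat _ _).
have uN : (u < N)%N by rewrite ltn_divLR // muln_gt0 expn_gt0.
have vt : value s (Op Div (step_expr k) (Nat k)) = (u %/ k)%N.
  exact: value_Div vu (value_Nat _ _).
(* In the extra round cell L of array 1 is read; it holds 0, in accordance with the default of
   [nth]. *)
have tL : (u %/ k < L.+1)%N by rewrite ltn_divLR.
have vz : value s (literal_expr k) = nth 0 w (u %/ k).
  by rewrite (value_Read _ vt) s1E.
have vabs : value s (Abs (literal_expr k)) = `|nth 0%R w (u %/ k)|%N.
  by rewrite value_Abs vz.
have vvar : value s (var_expr k) = `|nth 0%R w (u %/ k)|.-1.
  by apply: value_eqN (subn1 _); apply: value_Monus vabs (value_Nat _ _).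
have vsign : value s (Op Lt (Nat 0) (literal_expr k)) = (0 < nth 0 w (u %/ k)).
  exact: value_pos.
have vallowed : value s (allowed_expr k) = allowed k l w u a.
  rewrite /allowed; apply: value_Mul; first exact: value_Lt (value_Nat _ _) vabs.
  apply: value_Mul.
    exact: value_Eq (value_Div vvar value_len) (value_Mod vu (value_Nat _ _)).
  apply: value_Eq vsign; apply: value_Mod => //; apply: value_Div va _.
  apply: (value_Read_nat s2 (value_Mod vvar value_len)).
  by rewrite ltnW // ltnS ltn_pmod.
rewrite /entry; apply: value_Add; first apply: value_Add; first apply: value_Add.
- apply: value_Mul; first exact: value_Eq vi vu.
  apply: value_Add => //; apply: value_Mul => //; exact: value_Monus vallowed.
- apply: value_Mul; first exact: value_Lt vu value_carries.
  apply: value_Mul => //; exact: value_Eq vi (value_Add value_steps vu).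
- apply: value_Mul; first exact: value_Leq vu.
  apply: value_Mul.
    exact: value_Eq (value_Add vi (value_Nat _ _)) (value_Add value_steps vu).
  exact: value_Monus (value_Monus value_dim (value_Nat _ _)) va.
- apply: value_Mul => //; apply: (value_Eq vi); apply: value_Add.
    exact: value_Add value_steps value_carries.
  exact: value_Read_nat s4 vt _.
Qed.

End AfterZeros.

Hypothesis w_bound : forall t, (`|nth 0%R w t| <= n)%N.
Hypothesis B_large : (n + m + k + l + L + R * M + R + M + 4 * D + 10 <= B)%N.
Hypothesis leBW : (B ^ setup_cost k <= W)%N.

Let B_gt1 : (1 < B)%N. Proof. by lia. Qed.

Let fits_in (i : nat) : fits B (setup_cost k) (nth (Nat 0) (setup_exprs k) i).
Proof. by apply: setup_fits; lia. Qed.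

Lemma bounded_init : bounded B s0.
Proof.
have hw := w_bound; move=> a [j|j] //; rewrite /s0 /init.
case: a => [|[|a]] /=; last by rewrite nth_nil; case: a => [|a] /=; rewrite nth_nil.
  by case: j => [|[|j]] /=; rewrite ?nth_nil /=; lia.
apply: leq_trans (hw j) _; lia.
Qed.

Lemma reaches_pow :
  reaches W B (fill 2 3 (pow_cond k) pow_expr) s0
    (l.+2 * (ecost (pow_cond k) + ecost pow_expr + 10))
    (filled s0 2 3 (fun j => (2 ^ j)%N) l.+1).
Proof.
apply: (reaches_fill B_gt1 leBW _ _ (fits_in 0) (fits_in 1)) => //.
- exact: bounded_init.
- by apply/funext => -[j|j] //; rewrite /s0 /init /= nth_nil.
- by apply/funext => -[[|j]|j] //; rewrite /s0 /init /= nth_nil.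
- by lia.
- move=> i il /=; have : (2 ^ i <= D)%N by rewrite leq_exp2l.
  by lia.
- move=> i s il [s2 s3 sE]; have vi := value_Scalar s3; split.
    rewrite (value_Lt vi (y := (n %/ k + 2)%N)); first by rewrite (_ : (_ < _)%N); lia.
    apply: value_Add => //; apply: value_Div => //.
    by rewrite (value_Read _ (value_Nat _ _)) sE.
  apply: value_eqN; first apply: value_Add; first exact: value_Eq vi (value_Nat _ _).
    apply: value_Mul; first exact: value_Nat.
    exact: (value_Read_array_default s2 (value_Monus vi (value_Nat _ _))).
  case: i {il s2 s3 vi} => [|i] //; rewrite subSS subn0 ltnSn expnS.
  by lia.
- move=> s [_ s3 sE]; rewrite (value_Lt (value_Scalar s3) (y := (n %/ k + 2)%N)); first by lia.
  apply: value_Add => //; apply: value_Div => //.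
  by rewrite (value_Read _ (value_Nat _ _)) sE.
Qed.

Lemma zerosS (t : nat) : (t < L)%N ->
  zeros w t.+1 = (zeros w t + (nth 0%R w t == 0%R))%N.
Proof. by move=> tL; rewrite /zeros (take_nth 0) // -cats1 count_cat /= addn0. Qed.

Lemma reaches_zeros (s : state) : bounded B s ->
  (forall a, a != 2 -> a != 3 -> s a = s0 a) ->
  reaches W B (fill 4 5 zeros_cond zeros_expr) s
    (L.+2 * (ecost zeros_cond + ecost zeros_expr + 10))
    (filled s 4 5 (fun t => zeros w t) L.+1).
Proof.
move=> sB sE; apply: (reaches_fill B_gt1 leBW _ _ (fits_in 2) (fits_in 3)) => //.
- by rewrite sE //; apply/funext => -[j|j] //; rewrite /s0 /init /= nth_nil.
- by rewrite sE //; apply/funext => -[[|j]|j] //; rewrite /s0 /init /= nth_nil.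
- by lia.
- move=> t tL /=; have : (zeros w t <= m)%N by rewrite -zeros_size zeros_mono.
  by lia.
- move=> t s' tL [s4 s5 s'E]; have vt := value_Scalar s5.
  have vprev := value_Read_array_default s4 (value_Monus vt (value_Nat _ 1)).
  have vm : value s' clause_count = m.
    by rewrite (value_Read _ (value_Nat _ _)) s'E // sE.
  split.
    rewrite (value_Add (value_Eq vt (value_Nat _ _)) (value_Lt vprev vm)).
    case: t tL {s4 s5 vt vprev} => [|t] // tL; rewrite subSS subn0 ltnSn zeros_lt //.
  have vlit : value s' (Read 1 (Monus (Scalar 5) (Nat 1))) = nth 0 w (t - 1).
    by rewrite (value_Read _ (value_Monus vt (value_Nat _ _))) s'E // sE.
  rewrite (value_Mul (value_Lt (value_Nat _ _) vt) (value_Add vprev (value_eq0 vlit))).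
  case: t tL {s4 s5 vt vprev vlit} => [|t] tL; first by rewrite /zeros take0.
  by rewrite subSS subn0 ltnSn mul1n zerosS.
- move=> s' [s4 s5 s'E]; have vt := value_Scalar s5.
  have vprev := value_Read_array_default s4 (value_Monus vt (value_Nat _ 1)).
  have vm : value s' clause_count = m.
    by rewrite (value_Read _ (value_Nat _ _)) s'E // sE.
  rewrite (value_Add (value_Eq vt (value_Nat _ _)) (value_Lt vprev vm)).
  by rewrite subSS subn0 ltnSn zeros_size ltnn.
Qed.

(** The data that the last two loops read. These loops write to arrays 6 to 9 only, hence preserve
    it. *)
Definition prepared (s : state) :=
  [/\ s 2 = array l.+1 (fun j => (2 ^ j)%N), s 3 = cell l.+1,
      s 4 = array L.+1 (fun t => zeros w t), s 5 = cell L.+1 &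
     s 0 = s0 0 /\ s 1 = s0 1].

Lemma prepared_frame (s s' : state) :
  prepared s -> (forall a, (a < 6)%N -> s' a = s a) -> prepared s'.
Proof. by move=> [s2 s3 s4 s5 [sn sw]] E; split; rewrite !E. Qed.

Lemma reaches_entry (s : state) : bounded B s -> (0 < M)%N -> prepared s ->
  s 6 = s0 6 -> s 8 = s0 8 ->
  reaches W B (fill 8 6 (entry_cond k) (entry_expr k)) s
    ((R * M).+1 * (ecost (entry_cond k) + ecost (entry_expr k) + 10))
    (filled s 8 6 (fun p => col_entry k l w (p %/ M) (p %% M)) (R * M)).
Proof.
move=> sB M0 prep s6 s8.
have prep' s' : (forall a, a != 8 -> a != 6 -> s' a = s a) -> prepared s'.
  by move=> E; apply: prepared_frame prep _ => a a6; apply: E; lia.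
apply: (reaches_fill B_gt1 leBW _ _ (fits_in 4) (fits_in 5)) => //.
- by rewrite s8; apply/funext => -[j|j] //; rewrite /s0 /init /= nth_nil.
- by rewrite s6; apply/funext => -[[|j]|j] //; rewrite /s0 /init /= nth_nil.
- by lia.
- by move=> p _ /=; have := col_entry_bound k l w (p %/ M) (p %% M); lia.
- move=> p s' pRM [_ s'6 /prep'[s'2 s'3 s'4 s'5 [s'n s'w]]].
  split; last exact: value_entry.
  rewrite (value_Lt (value_Scalar s'6) (value_Mul (value_rows s'5 s'n) (value_cols s'2 s'3 s'5))).
  by rewrite pRM.
- move=> s' [_ s'6 /prep'[s'2 s'3 s'4 s'5 [s'n s'w]]].
  rewrite (value_Lt (value_Scalar s'6) (value_Mul (value_rows s'5 s'n) (value_cols s'2 s'3 s'5))).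
  by rewrite ltnn.
Qed.

Lemma reaches_rhs (s : state) : bounded B s -> prepared s ->
  s 7 = s0 7 -> s 9 = s0 9 ->
  reaches W B (fill 9 7 (rhs_cond k) (rhs_expr k)) s
    (R.+1 * (ecost (rhs_cond k) + ecost (rhs_expr k) + 10))
    (filled s 9 7 (fun i => rhs k l w i) R).
Proof.
move=> sB prep s7 s9.
have prep' s' : (forall a, a != 9 -> a != 7 -> s' a = s a) -> prepared s'.
  by move=> E; apply: prepared_frame prep _ => a a6; apply: E; lia.
apply: (reaches_fill B_gt1 leBW _ _ (fits_in 6) (fits_in 7)) => //.
- by rewrite s9; apply/funext => -[j|j] //; rewrite /s0 /init /= nth_nil.
- by rewrite s7; apply/funext => -[[|j]|j] //; rewrite /s0 /init /= nth_nil.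
- by lia.
- move=> i iR /=; case: (rhs_cases k_gt0 l_gt0 iR) => [[_ ->]|[v _ [_ ->]]|[r _ [_ ->]]].
  + by lia.
  + by rewrite -/D; lia.
  + by lia.
- move=> i s' iR [_ s'7 /prep'[s'2 s'3 s'4 s'5 [s'n s'w]]].
  split; last exact: value_rhs.
  by rewrite (value_Lt (value_Scalar s'7) (value_rows s'5 s'n)) iR.
- move=> s' [_ s'7 /prep'[s'2 s'3 s'4 s'5 [s'n s'w]]].
  by rewrite (value_Lt (value_Scalar s'7) (value_rows s'5 s'n)) ltnn.
Qed.

Lemma reaches_setup :
  reaches W B (setup k) (init [:: [:: n%:Z; m%:Z]; w])
    (B * (10 * (setup_cost k + 10)))
    (fun s => forall a, s (ip_array a) = init (encode_ip (reduction k l m w)) a).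
Proof.
have M0 : (0 < M)%N by have [] := nonneg_reduction m w k_gt0 l_gt0.
have kB : (k + 2 <= B)%N by lia.
have fr : fits B (setup_cost k) (rows_expr k) := setup_fits 8 kB.
have fc : fits B (setup_cost k) (cols_expr k) := setup_fits 9 kB.
have cost4 : (4 <= setup_cost k)%N := leq_addl _ 4.
have fNat x : (x <= B)%N -> fits B (setup_cost k) (Nat x) by rewrite /fits /=; lia.
have [f0 f1] := (fNat 0%N isT, fNat 1%N (ltnW B_gt1)).
pose c := (setup_cost k + 10)%N.
apply: (@reaches_weaken _ _ _ _
  (l.+2 * (2 * c) + (L.+2 * (2 * c) + ((R * M).+1 * (2 * c) + (R.+1 * (2 * c) + (c + c)))))%N
  _ _ _ _ (fun s _ => id)).
  apply: (@leq_trans ((l + L + R * M + R + 7) * (2 * c))%N); first by lia.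
  apply: (@leq_trans ((5 * B) * (2 * c))%N); last by rewrite /c; lia.
  by rewrite leq_mul2r; apply/orP; right; lia.
have cost_le i j : (ecost (nth (Nat 0) (setup_exprs k) i) +
    ecost (nth (Nat 0) (setup_exprs k) j) + 10 <= 2 * c)%N.
  have /andP[] := setup_fits i kB; have /andP[] := setup_fits j kB; rewrite /c; lia.
have [c1 c2] := (cost_le 0%N 1%N, cost_le 2%N 3%N).
have [c3 c4] := (cost_le 4%N 5%N, cost_le 6%N 7%N).
apply: reaches_seq.
  apply: (reaches_weaken _ (fun s' _ Qs' => Qs') reaches_pow).
  by rewrite leq_mul2l c1 orbT.
move=> s1 s1B [s12 s13 s1E]; apply: reaches_seq.
  apply: (reaches_weaken _ (fun s' _ Qs' => Qs') (reaches_zeros s1B s1E)).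
  by rewrite leq_mul2l c2 orbT.
move=> s2 s2B [s24 s25 s2E].
have prep2 : prepared s2.
  by split=> //; [rewrite s2E | rewrite s2E | split; rewrite s2E // s1E].
apply: reaches_seq.
  apply: (reaches_weaken _ (fun s' _ Qs' => Qs') (reaches_entry s2B M0 prep2 _ _)).
  - by rewrite leq_mul2l c3 orbT.
  - by rewrite s2E // s1E.
  - by rewrite s2E // s1E.
move=> s3 s3B [s38 s36 s3E].
have prep3 : prepared s3.
  by apply: prepared_frame prep2 _ => a a6; apply: s3E; lia.
apply: reaches_seq.
  apply: (reaches_weaken _ (fun s' _ Qs' => Qs') (reaches_rhs s3B prep3 _ _)).
  - by rewrite leq_mul2l c4 orbT.
  - by rewrite s3E // s2E // s1E.
  - by rewrite s3E // s2E // s1E.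
move=> s4 s4B [s49 s47 s4E].
have [s42 s43 s44 s45 [s4n s4w]] : prepared s4.
  by apply: prepared_frame prep3 _ => a a6; apply: s4E; lia.
have vR := value_rows s45 s4n.
have vM := value_cols s42 s43 s45.
have cR : ((ecost (Nat 0) + ecost (rows_expr k)).+1 <= c)%N.
  by case/andP: fr => + _; rewrite /c /=; lia.
have cM : ((ecost (Nat 1) + ecost (cols_expr k)).+1 <= c)%N.
  by case/andP: fc => + _; rewrite /c /=; lia.
(* The order matters: [rows_expr] reads m in cell 1 of array 0, which the next write overwrites,
   whereas [cols_expr] does not read array 0. *)
apply: (@reaches_seq _ _ _ _ _ _ _ (fun s => s = update s4 0 0 R)).
  apply: (reaches_weaken cR (fun s' _ Qs' => Qs')).
  by apply: (reaches_write B_gt1 leBW) => //; rewrite vR //=; lia.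
move=> s5 s5B s5E; apply: (reaches_weaken cM (fun s' _ Qs' => Qs')).
have other a : a != 0%N -> s5 a = s4 a.
  by move=> a0; apply/funext => j; rewrite s5E /update (negbTE a0).
have {}vM : value s5 (cols_expr k) = M by apply: value_cols; rewrite other.
apply: (reaches_write B_gt1 leBW) => //; rewrite vM //=; first by lia.
rewrite encode_reduction // => -[|a].
  apply/funext => -[[|[|j]]|j]; rewrite /update /= ?s5E /update //= s4n /= ?nth_nil //.
have -> : update s5 0 1 M (ip_array a.+1) = s4 (ip_array a.+1).
  by apply/funext => j; rewrite /update /= other.
case: a => [|[|a]]; rewrite /ip_array /=.
- by rewrite s4E // s38 -init_mkseq.
- by rewrite s49 -init_mkseq.
- rewrite s4E ?s3E ?s2E ?s1E; try by lia.
  by apply/funext => -[j|j] //=; rewrite !nth_nil.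
Qed.

End SetupCorrect.

(** * The reduction applied to a formula *)

Section RunReduction.
Variables (k q : nat) (F : cnf).
Hypotheses (k_gt0 : (0 < k)%N) (F_q : is_qcnf q F).

Let n := nvars F.
Let m := size (clauses F).
Let w := dimacs (int_clauses F).

Definition block_size := (n %/ k).+1.
Definition sat_ip := reduction k block_size m w.

Definition word_size :=
  (n + m + k + block_size + size w + num_rows k m w * num_cols k block_size w +
   num_rows k m w + num_cols k block_size w + 4 * 2 ^ block_size + 10)%N.

Lemma sat_ip_size : (nrows sat_ip * ncols sat_ip <= word_size)%N.
Proof.
rewrite /word_size /=; set RM := (num_rows _ _ _ * num_cols _ _ _)%N.
by move: (num_rows _ _ _) (num_cols _ _ _) (4 * _)%N RM => r c d rm; lia.
Qed.

Lemma leq_nvars_blocks : (n <= k * block_size)%N.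
Proof. by rewrite mulnC ltnW // ltn_ceil. Qed.

Lemma literal_bound (t : nat) : (`|nth 0%R w t| <= n)%N.
Proof.
have [tw|wt] := ltnP t (size w); last by rewrite nth_default.
exact/mem_dimacs/mem_nth.
Qed.

Lemma feasible_sat_ip : feasible sat_ip <-> satisfiable F.
Proof.
have zs : zeros w (size w) = m.
  by rewrite zeros_dimacs_size ?int_clauses_nonzero // size_map.
rewrite satisfiable_witnessed feasible_reduction.
rewrite nat_feasible_choosable // choosable_witnessed // => t.
exact: leq_trans (literal_bound t) leq_nvars_blocks.
Qed.

Lemma run_reduction (P : cmd) (W t : nat) (s : state) :
  exec W P (init (encode_ip sat_ip)) t s ->
  exists t' s', [/\ exec (W + word_size ^ setup_cost k) (Seq (setup k) (rename ip_array P))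
                      (init (encode_cnf F)) t' s',
                    (t' <= word_size * (10 * (setup_cost k + 10)) + t)%N &
                    s' 0%N = s 0%N].
Proof.
move=> Pexec; rewrite encode_cnfE.
have zs : zeros w (size w) = m.
  by rewrite zeros_dimacs_size ?int_clauses_nonzero // size_map.
have zl u : (u < size w)%N -> (zeros w u < m)%N.
  move=> uw; rewrite /m -(size_map (map (@encode_literal _))).
  by rewrite zeros_dimacs_lt // int_clauses_nonzero.
have [t1 [s1 [H1 t1b _ s1E]]] := reaches_setup k_gt0 (erefl block_size) zl zs literal_bound
  (leqnn word_size) (leq_addl W (word_size ^ setup_cost k)).
have [s2 [H2 s2E]] := exec_rename ip_array_inj
  (exec_mono (leq_addr (word_size ^ setup_cost k) W) Pexec) s1E.
exists (t1 + t)%N, s2; split; first exact: ExecSeq H1 H2.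
  by rewrite leq_add2r.
by rewrite -(s2E 0%N).
Qed.

(** A q-CNF text has length at most m (q + 1), so rows and columns number O(k (q + 1) (m + 1)), the
    columns with a further factor 2 * 2 ^ l. It is essential that 2 ^ l occurs only once: the power
    C of the size then adds C to its exponent. The constant 50 is slack. *)
Lemma word_size_bound :
  (word_size <= 50 * (k * q.+1) ^ 2 * (2 ^ block_size * m.+1 ^ 2))%N.
Proof.
have sw : ((size w).+1 <= m.+1 * q.+1)%N.
  by have := size_dimacs_qcnf F_q; rewrite -/w -/m; lia.
have nk := leq_nvars_blocks.
have lD : (block_size <= 2 ^ block_size)%N by apply/ltnW/ltn_expl.
rewrite /word_size /num_rows /num_cols /steps.
set D := (2 ^ block_size)%N in lD *; set l := block_size in nk lD *.
set Y := m.+1 in sw *; have mY : (m < Y)%N by [].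
set a := (k * q.+1)%N; set Z := (D * Y ^ 2)%N.
have D1 : (1 <= D)%N by rewrite expn_gt0.
have a1 : (1 <= a)%N by rewrite muln_gt0 k_gt0.
have ka : (k <= a)%N by rewrite leq_pmulr.
have aa : (a <= a ^ 2)%N by rewrite -{1}(expn1 a) leq_pexp2l.
have Y1 : (1 <= Y)%N by [].
have YY : (Y <= Y ^ 2)%N by rewrite -{1}(expn1 Y) leq_pexp2l.
have DZ : (D <= Z)%N by rewrite leq_pmulr // expn_gt0.
have YZ : (Y <= Z)%N by rewrite (leq_trans YY) // leq_pmull.
have DYZ : (D * Y <= Z)%N by rewrite leq_mul2l YY orbT.
have Lk : ((size w).+1 * k <= a * Y)%N.
  by rewrite (leq_trans (leq_mul sw (leqnn k))) // /a; lia.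
have rows : ((size w).+1 * k + size w * k + m <= 3 * (a * Y))%N.
  by have : (Y <= a * Y)%N := leq_pmull _ a1; lia.
have cols : ((size w).+1 * k * (2 * D) <= 2 * (a * (D * Y)))%N.
  by rewrite (leq_trans (leq_mul Lk (leqnn (2 * D)))) //; lia.
have prod : (((size w).+1 * k + size w * k + m) * ((size w).+1 * k * (2 * D))
    <= 6 * (a ^ 2 * Z))%N.
  rewrite (leq_trans (leq_mul rows cols)) // /Z !expnS !expn0; lia.
have aZ : (a * Z <= a ^ 2 * Z)%N by rewrite leq_mul2r aa orbT.
have Z1 : (Z <= a * Z)%N by rewrite leq_pmull.
have aYZ : (a * Y <= a * Z)%N by rewrite leq_mul2l YZ orbT.
have aDYZ : (a * (D * Y) <= a * Z)%N by rewrite leq_mul2l DYZ orbT.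
have kD : (k * l <= a * Z)%N by apply: leq_mul => //; apply: leq_trans lD DZ.
have sL : (size w <= a * Y)%N.
  by rewrite (leq_trans _ Lk) // (leq_trans (leqnSn _)) // leq_pmulr.
have ka2 : (k <= a * Z)%N by rewrite (leq_trans ka) // leq_pmulr // (leq_trans D1).
have -> : (50 * a ^ 2 * Z = 50 * (a ^ 2 * Z))%N by rewrite mulnA.
move: prod aZ Z1 aYZ aDYZ kD sL ka2 nk lD DZ YZ rows cols mY D1.
set G := (a ^ 2 * Z)%N; set RM := (_ * _ * _)%N.
lia.
Qed.

Lemma sum_mkseq_leq (h : nat -> nat) (r x : nat) : (forall i, (i < r)%N -> (h i <= x)%N) ->
  (\sum_(v <- mkseq (fun i => (h i)%:Z) r) `|v|%N.+1 <= r * x.+1)%N.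
Proof.
move=> hx; rewrite big_map big_seq.
apply: (@leq_trans (\sum_(i <- iota 0 r | i \in iota 0 r) x.+1)).
  by apply: leq_sum => i; rewrite mem_iota => /andP[_ ir]; rewrite ltnS hx.
by rewrite -big_seq big_const_seq count_predT size_iota iter_addn_0 mulnC.
Qed.

Lemma magnitude_sat_ip : (magnitude (encode_ip sat_ip) <= 5 * word_size ^ 2)%N.
Proof.
rewrite encode_reduction // /magnitude !big_cons !big_nil !addn0.
set R := num_rows _ _ _; set M := num_cols _ _ _.
have RB : (R <= word_size)%N by rewrite /word_size -/R -/M; lia.
have MB : (M <= word_size)%N by rewrite /word_size -/R -/M; lia.
have RMB : (R * M + 10 <= word_size)%N by rewrite /word_size -/R -/M; lia.
have DB : (2 * 2 ^ block_size + 3 <= word_size)%N by rewrite /word_size -/R -/M; lia.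
have h1 := @sum_mkseq_leq (fun p => col_entry k block_size w (p %/ M) (p %% M)) (R * M)
  word_size.
have h2 := @sum_mkseq_leq (fun i => rhs k block_size w i) R word_size.
apply: leq_trans (leq_add (leqnn _) (leq_add (h1 _) (h2 _))) _.
- by move=> p _; apply: leq_trans (col_entry_bound _ _ _ _ _) DB.
- move=> i iR; have iR' : (i < num_rows k m w)%N by [].
  by case: (@rhs_cases k block_size m w k_gt0 isT i iR') => [[_ ->]|[v _ [_ ->]]|[r _ [_ ->]]]; lia.
- rewrite /= expnS expn1.
  have := leq_mul RMB (leqnn word_size.+1); have := leq_mul RB (leqnn word_size.+1).
  nia.
Qed.

End RunReduction.

(** * Time bounds *)

Section RealBounds.
Local Open Scope classical_set_scope.
Variable R : realType.

(** By convention [inf] is 0 on a set without a lower bound; [0 <= c] covers that case. *)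
Lemma delta_leq (q : nat) (c : R) : 0 <= c ->
  (exists C, @solvable_in_time R (qSAT q) (qSAT_bound c C)) -> delta R q <= c.
Proof.
move=> c0 solv; rewrite /delta; set S := [set _ | _].
have Sc : S c by [].
have [lb|nlb] := pselect (has_lbound S); first exact: ge_inf.
by rewrite inf_out // => -[].
Qed.

(** Rounding the block length up costs l k <= n + k, hence l E <= c l k <= c n + k: a constant
    factor 2 ^ k. *)
Lemma pow_block_leq (k : nat) (F : cnf) (c E : R) :
  (0 < k)%N -> 0 <= E -> E <= c * k%:R -> c <= 1 ->
  (2 ^ block_size k F)%N%:R `^ E <= 2 ^+ k * 2 `^ (c * (nvars F)%:R) :> R.
Proof.
move=> k0 E0 Ek c1; set n := nvars F.
have kR : 0 < k%:R :> R by rewrite ltr0n.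
have lk : (block_size k F)%:R * k%:R <= n%:R + k%:R :> R.
  by rewrite -natrM -natrD ler_nat /block_size mulSn addnC leq_add2r leq_divM.
rewrite natrX -powR_mulrn // -powRrM -[2 ^+ k]powR_mulrn // -powRD ?pnatr_eq0 ?implybT //.
apply: ler_powR; first by rewrite ler1n.
set l := (block_size k F)%:R in lk *; have l0 : 0 <= l by rewrite ler0n.
have n0 : 0 <= n%:R :> R by rewrite ler0n.
have : l * E <= l * (c * k%:R) by apply: ler_wpM2l.
have cpos : 0 <= c by rewrite -(pmulr_lge0 _ kR); apply: le_trans Ek.
have : c * (l * k%:R) <= c * (n%:R + k%:R) by apply: ler_wpM2l.
have : c * k%:R <= k%:R by rewrite ler_piMl // ltW.
by lra.
Qed.

(** With V = 2 + x + T one has 2 + mg + Tp <= 8 V^2 <= V^5, as V >= 2; this explains the factor 5.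
    The last factor V absorbs the 2 in p + r <= 2 p r. *)
Lemma word_real_bound (KP Ks : nat) (x mg T : R) (Wp B : nat) :
  0 <= T -> 0 <= x -> B%:R <= T -> mg <= 5 * B%:R ^+ 2 -> 0 <= mg ->
  forall Tp : R, 0 <= Tp -> Tp <= T -> Wp%:R <= (2 + mg + Tp) ^+ KP ->
  (Wp + B ^ Ks)%N%:R <= (2 + x + T) ^+ (5 * KP + Ks + 1).
Proof.
move=> T0 x0 BT mgB mg0 Tp Tp0 TpT Wpb; set V := 2 + x + T.
have V2 : 2 <= V by rewrite /V; lra.
have B0 : 0 <= B%:R :> R by rewrite ler0n.
have V0 : 0 <= V by lra.
have BV : B%:R <= V by rewrite /V; lra.
have V4 : 4 <= V ^+ 2 by rewrite expr2; nra.
have B2 : B%:R ^+ 2 <= V ^+ 2 by rewrite lerXn2r ?nnegrE.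
have V8 : 8 * V ^+ 2 <= V ^+ 5.
  have -> : V ^+ 5 = V * V ^+ 2 * V ^+ 2 by ring.
  apply: ler_wpM2r; first by rewrite exprn_ge0.
  have : 2 * 4 <= V * V ^+ 2 by apply: ler_pM; lra.
  lra.
have V1 : 2 + mg + Tp <= V ^+ 5.
  have : V <= V ^+ 2 by rewrite expr2; nra.
  have : 2 + Tp <= V by rewrite /V; lra.
  lra.
have h1 : Wp%:R <= V ^+ (5 * KP).
  by rewrite exprM; apply: le_trans Wpb _; rewrite lerXn2r ?nnegrE ?exprn_ge0 //; lra.
have h2 : (B ^ Ks)%N%:R <= V ^+ Ks by rewrite natrX lerXn2r ?nnegrE.
have g1 : 1 <= V ^+ (5 * KP) by apply: exprn_ege1; lra.
have g2 : 1 <= V ^+ Ks by apply: exprn_ege1; lra.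
rewrite natrD 2!exprD expr1; set p := V ^+ _ in h1 g1 *; set r := V ^+ Ks in h2 g2 *.
have : p + r <= p * r * 2.
  have : 0 <= (p - 1) * r + p * (r - 1) by apply: addr_ge0; apply: mulr_ge0; lra.
  lra.
have : p * r * 2 <= p * r * V by apply: ler_wpM2l => //; apply: mulr_ge0; lra.
lra.
Qed.

(** The path-width is known only up to an upper bound and [f] need not be monotone, so the sum over
    all possible values replaces [f]. The power of d + 1 is monotone because d + 1 >= 1 and 1 - e >=
    0. *)
Lemma IP_bound_sat (f : nat -> R) (eps e c : R) (C k q : nat) (F : cnf) :
  (0 < k)%N -> 0 < e -> e <= 1 -> e <= eps -> c <= 1 ->
  (1 - e) * (k + 4)%:R + C%:R <= c * k%:R -> is_qcnf q F ->
  IP_bound f eps C (sat_ip k F) <=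
  (\sum_(j < k + 5) `|f j|) * (50 * (k * q.+1) ^ 2)%N%:R ^+ C *
  (2 ^+ k * 2 `^ (c * (nvars F)%:R)) * ((size (clauses F)).+1%:R ^+ 2) ^+ C.
Proof.
move=> k0 e0 e1 eeps c1 ck Fq; rewrite /IP_bound.
set D := (2 ^ block_size k F)%N; set I := sat_ip k F.
have pw : (pathwidth (constraint I) <= k + 4)%N by apply: pathwidth_reduction.
set p := pathwidth _ in pw *.
have D1 : 1 <= D%:R :> R by rewrite ler1n expn_gt0.
have d0 : 0 <= max_target I.
  by rewrite /max_target; elim/big_ind: _ => // [x y x0 y0|i _]; [rewrite le_max x0 | rewrite mxE].
have dD : (max_target I)%:~R + 1 <= D%:R :> R.
  have := @max_target_reduction k (block_size k F) (size (clauses F))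
    (dimacs (int_clauses F)) k0 isT.
  rewrite -/I -/D -(ler_int R) => h; rewrite -[D]prednK ?expn_gt0 // -natr1 lerD2r.
  exact: h.
have d1 : 1 <= (max_target I)%:~R + 1 :> R by rewrite lerDr ler0z.
have fp : f p <= \sum_(j < k + 5) `|f j|.
  have pk : (p < k + 5)%N by lia.
  rewrite (bigD1 (Ordinal pk)) //= (le_trans (ler_norm _)) // lerDl.
  by apply: sumr_ge0 => j _.
have f0 : 0 <= \sum_(j < k + 5) `|f j| by apply: sumr_ge0.
set E := (1 - e) * (k + 4)%:R in ck *.
have E0 : 0 <= E by apply: mulr_ge0; [lra | rewrite ler0n].
have expE : ((max_target I)%:~R + 1) `^ ((1 - eps) * p%:R) <= D%:R `^ E :> R.
  apply: (@le_trans _ _ (((max_target I)%:~R + 1) `^ E)).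
    apply: ler_powR => //; apply: (@le_trans _ _ ((1 - e) * p%:R)).
      by apply: ler_wpM2r; [rewrite ler0n | lra].
    by apply: ler_wpM2l; [lra | rewrite ler_nat].
  by apply: ge0_ler_powR => //; rewrite nnegrE; lra.
set S := \sum_(j < _) _ in fp f0 *.
set Y := (size (clauses F)).+1; set c0 := (50 * (k * q.+1) ^ 2)%N.
have rc : (nrows I * ncols I)%N%:R ^+ C <= (c0%:R * (D%:R * Y%:R ^+ 2)) ^+ C :> R.
  rewrite lerXn2r ?nnegrE ?ler0n ?mulr_ge0 ?exprn_ge0 ?ler0n //.
  rewrite -natrX -!natrM ler_nat; apply: leq_trans (word_size_bound k0 Fq).
  exact: sat_ip_size.
apply: (@le_trans _ _ (S * D%:R `^ E * (c0%:R * (D%:R * Y%:R ^+ 2)) ^+ C)).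
  apply: (@le_trans _ _ (S * ((max_target I)%:~R + 1) `^ ((1 - eps) * p%:R) *
      (nrows I * ncols I)%N%:R ^+ C)).
    apply: ler_wpM2r; first by rewrite exprn_ge0 // ler0n.
    by apply: ler_wpM2r => //; apply: powR_ge0.
  apply: ler_pM => //; first by rewrite mulr_ge0 ?powR_ge0.
  exact: ler_wpM2l.
have := pow_block_leq F k0 (addr_ge0 E0 (ler0n _ C)) ck c1; rewrite -/D.
rewrite powRD; last by rewrite (gt_eqF (lt_le_trans ltr01 D1)) implybT.
rewrite powR_mulrn ?(le_trans ler01) // => main.
have -> : S * D%:R `^ E * (c0%:R * (D%:R * Y%:R ^+ 2)) ^+ C =
  S * c0%:R ^+ C * (D%:R `^ E * D%:R ^+ C) * (Y%:R ^+ 2) ^+ C.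
  by rewrite !exprMn; ring.
apply: ler_wpM2r; first by rewrite !exprn_ge0 ?ler0n.
by apply: ler_wpM2l => //; rewrite mulr_ge0 // exprn_ge0 // ler0n.
Qed.
End RealBounds.

(* With enough blocks, the [O(1)] overhead of the path-width over the number [k] of
   blocks and the size of the instance, polynomial in [2 ^ (n / k)], are both
   absorbed by half of [e]. *)
Lemma solvable_qSAT (R : realType) (f : nat -> R) (eps e : R) (C q : nat) :
  0 < e -> e <= 1 -> e <= eps ->
  @solvable_in_time R IP_nonneg (IP_bound f eps C) ->
  exists C', @solvable_in_time R (qSAT q) (qSAT_bound (1 - e / 2) C').
Proof.
move=> e0 e1 eeps [P [KP solve]].
pose c := 1 - e / 2.
have C0 : 0 <= C%:R :> R by rewrite ler0n.
have [k ke] : exists k : nat, 2 * (C%:R + 4) <= k%:R * e.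
  exists (Num.bound (2 * (C%:R + 4) / e)).
  by rewrite -ler_pdivrMr // ltW // archi_boundP // divr_ge0 ?(ltW e0) //; lra.
have kR : 8 <= k%:R :> R.
  have : k%:R * e <= k%:R by rewrite ler_piMr.
  lra.
have k0 : (0 < k)%N by rewrite -(ltr0n R); lra.
have ck : (1 - e) * (k + 4)%:R + C%:R <= c * k%:R by rewrite /c natrD; lra.
have c1 : c <= 1 by rewrite /c; lra.
have c_ge : 1 / 2 <= c by rewrite /c; lra.
pose A := (50 * (k * q.+1) ^ 2)%N; pose A' := (10 * (setup_cost k + 10))%N.
pose S := \sum_(j < k + 5) `|f j|.
have S0 : 0 <= S by apply: sumr_ge0.
pose G := (S * A%:R ^+ C + (A * A')%N%:R) * 2 ^+ k.
(* A single constant is both factor and exponent in [qSAT_bound]: it must exceed [G] as well as the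
   exponents 2 C and 2 of the number of clauses. *)
pose C' := (2 * C + 2 + Num.bound G)%N.
exists C'; exists (Seq (setup k) (rename ip_array P)), (5 * KP + setup_cost k + 1)%N.
move=> F Fq; set T := qSAT_bound _ _ _.
have nonneg : is_nonneg (sat_ip k F) by apply: nonneg_reduction.
have [W [t [s [Hexec tT Wb sE]]]] := solve (sat_ip k F) nonneg.
have [t' [s' [H' t'b s'E]]] := run_reduction k0 Hexec.
exists (W + word_size k F ^ setup_cost k)%N, t', s'.
set n := nvars F in T *; set Y := (size (clauses F)).+1 in T *.
pose X : R := 2 `^ (c * n%:R).
have X1 : 1 <= X.
  rewrite -(powRr0 2); apply: ler_powR; first by rewrite ler1n.
  by apply: mulr_ge0; [lra | rewrite ler0n].
have Y1 : 1 <= Y%:R :> R by rewrite ler1n.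
have X0 : 0 <= X by lra.
have pk0 : 0 <= 2 ^+ k :> R by rewrite exprn_ge0.
have TE : T = C'%:R * X * Y%:R ^+ C' by [].
have ipT : IP_bound f eps C (sat_ip k F) <= S * A%:R ^+ C * (2 ^+ k * X) * (Y%:R ^+ 2) ^+ C.
  by apply: (@IP_bound_sat _ _ _ e).
have BT : (word_size k F * A')%N%:R <= (A * A')%N%:R * (2 ^+ k * X) * Y%:R ^+ 2 :> R.
  have h := word_size_bound k0 Fq.
  (* The set-up time contains one factor 2 ^ l, the case E = 1; it fits because c k >= k / 2 >=
     1. *)
  have D2 : (2 ^ block_size k F)%N%:R <= 2 ^+ k * X.
    have := @pow_block_leq R k F c 1 k0 ler01; rewrite powRr1 ?ler0n //; apply=> //.
    by have : 1 / 2 * k%:R <= c * k%:R by [apply: ler_wpM2r; lra]; lra.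
  apply: (@le_trans _ _ (A * (2 ^ block_size k F * Y ^ 2) * A')%N%:R).
    by rewrite ler_nat leq_mul2r h orbT.
  have -> : (A * (2 ^ block_size k F * Y ^ 2) * A')%N%:R =
      (A * A')%N%:R * (2 ^ block_size k F)%N%:R * Y%:R ^+ 2 :> R.
    by rewrite -natrX -!natrM; congr (_%:R); ring.
  by apply: ler_wpM2r; [rewrite exprn_ge0 | apply: ler_wpM2l].
have ip0 : 0 <= IP_bound f eps C (sat_ip k F) by apply: le_trans tT; rewrite ler0n.
have total : (word_size k F * A')%N%:R + IP_bound f eps C (sat_ip k F) <= T.
  have G0 : 0 <= G.
    by rewrite mulr_ge0 // addr_ge0 ?ler0n // mulr_ge0 // exprn_ge0 // ler0n.
  have GC : G <= C'%:R.
    by rewrite (le_trans (ltW (archi_boundP G0))) // ler_nat leq_addl.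
  have YC j : (j <= C')%N -> Y%:R ^+ j <= Y%:R ^+ C' :> R by move=> jC; rewrite ler_weXn2l.
  apply: le_trans (lerD BT ipT) _.
  apply: (@le_trans _ _ (G * X * Y%:R ^+ C')); last first.
    rewrite TE; apply: ler_wpM2r; first by rewrite exprn_ge0 ?ler0n.
    exact: ler_wpM2r.
  have -> : G * X * Y%:R ^+ C' = (A * A')%N%:R * (2 ^+ k * X) * Y%:R ^+ C' +
      S * A%:R ^+ C * (2 ^+ k * X) * Y%:R ^+ C' by rewrite /G; ring.
  have AX0 : 0 <= 2 ^+ k * X by apply: mulr_ge0.
  apply: lerD; apply: ler_wpM2l.
  - by rewrite mulr_ge0 ?ler0n.
  - exact: YC (leq_trans (leq_addl _ 2) (leq_addr _ _)).
  - by rewrite mulr_ge0 // mulr_ge0 // exprn_ge0 // ler0n.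
  - by rewrite -exprM; apply: YC (leq_trans (leq_addr 2 _) (leq_addr _ _)).
have T0 : 0 <= T by apply: le_trans total; rewrite addr_ge0 ?ler0n.
split=> //.
- apply: le_trans total; apply: (@le_trans _ _ (word_size k F * A' + t)%N%:R).
    by rewrite ler_nat.
  by rewrite natrD lerD2l.
- apply: (@word_real_bound _ _ _ _ (magnitude (encode_ip (sat_ip k F)))%:R _ _ _ T0
    _ _ _ _ (IP_bound f eps C (sat_ip k F))) => //; rewrite ?ler0n //.
  + apply: le_trans total; apply: (@le_trans _ _ (word_size k F * A')%N%:R).
      by rewrite ler_nat leq_pmulr.
    by rewrite lerDl.
  + by rewrite -natrX -natrM ler_nat magnitude_sat_ip.
  + by apply: le_trans total; rewrite lerDr ler0n.
- by rewrite s'E sE; apply: feasible_sat_ip.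
Qed.

Theorem theorem4 (R : realType) :
  SETH R ->
  forall (f : nat -> R) (eps : R), 0 < eps ->
    ~ exists C : nat, @solvable_in_time R IP_nonneg (IP_bound f eps C).
Proof.
move=> seth f eps eps0 [C solv].
(* The cap keeps the exponents 1 - e and 1 - e / 2 non-negative when [eps] exceeds 1. *)
pose e := Num.min eps 1.
have e0 : 0 < e by rewrite lt_min eps0 ltr01.
have e1 : e <= 1 by rewrite ge_min lexx orbT.
have eeps : e <= eps by rewrite ge_min lexx.
have bound q : delta R q <= 1 - e / 2.
  by apply: delta_leq; [lra | apply: (solvable_qSAT _ e0 e1 eeps solv)].
have : 1 <= 1 - e / 2 by apply: (cvgr_to_le seth); apply: nearW.
lra.
Qed.
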